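(* Let $\alpha([3]^n)$ be the number of antichains of the poset $[3]^n$, and let $\alpha(L_{[n-1,n+1]})$ be the number of antichains of $[3]^n$ contained in $L_{[n-1,n+1]}=L_{n-1}\cup L_n\cup L_{n+1}$. Then $$\alpha([3]^n)=\left(1+e^{-\Omega(n^2)}\right)\alpha(L_{[n-1,n+1]}).$$
   Context: $[3]^n=\{0,1,2\}^n$ with the coordinatewise order. For an integer $k$, the $k$-th layer is $L_k=\{v\in[3]^n:\sum_{i=1}^n v_i=k\}$. An antichain is a set of pairwise incomparable elements (the empty set included). The notation $1+e^{-\Omega(n^2)}$ denotes a quantity $1+\varepsilon_n$ with $|\varepsilon_n|\le e^{-cn^2}$ for some constant $c>0$ and all sufficiently large $n$. *)

(* Defs.v *)
From HB Require Import structures.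
From mathcomp Require Import all_boot all_order all_algebra.
From mathcomp Require Import all_classical all_reals all_analysis.

Set Implicit Arguments.
Unset Strict Implicit.
Unset Printing Implicit Defensive.

Import Order.TTheory GRing.Theory Num.Theory.
Import numFieldNormedType.Exports.

Local Open Scope ring_scope.

(* The library order on n.-tupleprod T is the coordinatewise one, whereas
   tuplelexi carries the lexicographic order. *)
Definition grid (n : nat) := n.-tupleprod 'I_3.

(* Layers are indexed by integers, so that layer n (n%:Z - 1) is the empty set
   for n = 0 rather than layer n 0. *)
Definition layer (n : nat) (k : int) : {set grid n} :=
  [set v : grid n | (\sum_(i < n) (tnth v i : nat))%N%:Z == k].

Definition middle_layers (n : nat) : {set grid n} :=
  layer n (n%:Z - 1) :|: layer n n%:Z :|: layer n (n%:Z + 1).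

Definition antichain (d : Order.disp_t) (T : finPOrderType d) (A : {set T}) :=
  [forall x in A, forall y in A, (x != y) ==> (x >< y)%O].

Definition nb_antichains (d : Order.disp_t) (T : finPOrderType d)
    (S : {set T}) : nat :=
  #|[set A : {set T} | antichain A & A \subset S]|.

Local Open Scope classical_set_scope.

Definition is_exp_neg_Omega (R : realType) (f eps : nat -> R) : Prop :=
  exists2 c : R, 0 < c & \forall n \near \oo, `|eps n| <= expR (- (c * f n)).

(* Main.v *)
(* It suffices that, for j <= n and k >= n+2, at most a fraction e^{-c n^2} of
   the antichains of L_j u ... u L_k meet L_k: the layers above n+1 are then
   removed one at a time, and reversing the order takes care of the lower ones.

   Fix v in L_k. In an antichain A containing v, link two elements of
   A n (L_k u L_{k-1}) when they have a common lower bound in L_{k-2}, and let W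
   be the component of v. Replacing W by an arbitrary subset of the set G of
   elements of L_{k-2} below W is injective once W is known, so W occurs in at
   most a fraction 2^{-|G|} of the antichains, where |G| >= n^2/8. The sum of
   2^{-|G|} over all W is bounded by Sapozhenko's method of graph containers: W
   is a subset of a container determined by a certificate which is a small
   linked set close to W. Two facts about shadows from L_m to L_{m-1}, m > n,
   make this work: they gain a factor 1 + c/n, and sets of polynomial size
   expand by a factor of order n / log n. *)
Require Import Defs.
From HB Require Import structures.
From mathcomp Require Import all_boot all_order all_algebra.
From mathcomp Require Import zify ring lra.

Set Implicit Arguments.
Unset Strict Implicit.
Unset Printing Implicit Defensive.
Import Order.TTheory GRing.Theory Num.Theory.

(** * Greedy covers and hitting sets *)

(** The obstacle is the tiny expansion. Just above the middle, the slack [t] by which the shadow of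
    a set exceeds its closure is only known to be of order g/n, where g is the size of the shadow,
    while a vertex of a certificate costs of order log n bits. A certificate thus needs far fewer
    than g/(n log n) vertices, and a plain greedy cover has about g/n. Neighbourhoods at distance
    two have about n^2 elements and can be hit by about g log n / n^2 vertices. What these miss has
    size at most K t with K polylogarithmic, and is repaired by greedy covers whose cost is measured
    against t instead of g. A cluster meets two layers and needs a container in each. The one in L_k
    only has to break even; the gain of order n^2 bits comes from the one in L_{k-1}. Both layers
    must lie above L_n, whence k >= n+2. Such a gain outweighs the e^{O(n)} choices of v and of the
    layer. *)

Lemma greedy_cover (I J : finType) (f : I -> {set J}) (Y : {set I})
    (Om : {set J}) (p : nat) :
  0 < p ->
  exists2 T : {set I}, T \subset Y &
    #|T| * p <= #|Om| /\
    (forall i, i \in Y -> #|(f i :&: Om) :\: \bigcup_(j in T) f j| < p).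
Proof.
move=> p_gt0.
(* A largest [T] among those covering at least [p] points per member works: an [i] violating the
   bound would bring [p] new points and could be added. *)
pose ok (T : {set I}) :=
  (T \subset Y) && (#|T| * p <= #|Om :&: \bigcup_(j in T) f j|).
have ok0 : ok set0 by rewrite /ok sub0set cards0 mul0n.
case: (arg_maxnP (fun T : {set I} => #|T|) ok0) => T /andP[TY Tp] maxT.
exists T => //; split; first by rewrite (leq_trans Tp) // subset_leq_card ?subsetIl.
move=> i iY; rewrite ltnNge; apply/negP => big.
have iT : i \notin T.
  apply/negP => iT; move: big; rewrite leqNgt => /negP; apply.
  rewrite (_ : _ :\: _ = set0) ?cards0 //; apply/eqP; rewrite setD_eq0.
  by rewrite subIset // bigcup_sup.
suff ok' : ok (i |: T).
  by have := maxT _ ok'; rewrite cardsU1 iT add1n => /leq_gtF; rewrite ltnSn.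
rewrite /ok cardsU1 iT mulnDl mul1n subUset sub1set iY TY /=.
rewrite (bigD1 i) ?setU11 //=.
have -> : \bigcup_(j in i |: T | j != i) f j = \bigcup_(j in T) f j.
  apply: eq_bigl => j; rewrite in_setU1; case: eqP => [->|] //=.
    by rewrite (negbTE iT).
  by rewrite andbT.
set B := \bigcup_(j in T) f j in Tp big *.
have -> : Om :&: (f i :|: B) = ((f i :&: Om) :\: B) :|: (Om :&: B).
  by apply/setP => x; rewrite !inE; do !case: (_ \in _).
rewrite cardsU (_ : _ :&: (Om :&: B) = set0) ?cards0 ?subn0 ?leq_add //.
by apply/setP => x; rewrite !inE; do !case: (_ \in _).
Qed.

(** A uniformly random point of [G] lies in a given [M i] with probability at least 1/q, so some
    point hits at least the average. *)
Lemma hitting_step (I J : finType) (M : I -> {set J}) (Y : {set I})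
    (G : {set J}) (q : nat) :
  (forall i, i \in Y -> [/\ M i \subset G, 0 < #|M i| & #|G| <= q * #|M i|]) ->
  0 < #|Y| ->
  exists2 h, h \in G & #|Y| <= q * #|[set i in Y | h \in M i]|.
Proof.
move=> hM /card_gt0P[i0 i0Y].
have dc : \sum_(h in G) #|[set i in Y | h \in M i]| = \sum_(i in Y) #|M i|.
  under eq_bigr do rewrite -sum1_card.
  rewrite (exchange_big_dep (mem Y)) /=; last by move=> h i _; rewrite inE => /andP[].
  apply: eq_bigr => i iY; rewrite -sum1_card; apply: eq_bigl => h.
  have [/subsetP MG _ _] := hM _ iY.
  by rewrite !inE iY /=; case E: (h \in M i); rewrite ?andbF // (MG _ E).
apply/exists_inP; apply/contraT; rewrite negb_exists => /forallP no.
have : \sum_(h in G) (q * #|[set i in Y | h \in M i]|).+1 <= \sum_(h in G) #|Y|.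
  by apply: leq_sum => h hG; have := no h; rewrite hG /= -ltnNge.
rewrite sum_nat_const; under eq_bigr do rewrite -addn1.
rewrite big_split /= -big_distrr /= dc sum_nat_const muln1 big_distrr /=.
have : #|Y| * #|G| <= \sum_(i in Y) q * #|M i|.
  rewrite -sum_nat_const; apply: leq_sum => i iY.
  by have [] := hM _ iY.
have : 0 < #|G|.
  have [MG M0 _] := hM _ i0Y; exact: leq_trans M0 (subset_leq_card MG).
nia.
Qed.

(** As long as more than half of [Y] is unhit, one further point hits more than |Y|/(2q) of the
    remaining sets, so [q] points suffice. *)
Lemma hitting_half (I J : finType) (M : I -> {set J}) (Y : {set I})
    (G : {set J}) (q : nat) :
  (forall i, i \in Y -> [/\ M i \subset G, 0 < #|M i| & #|G| <= q * #|M i|]) ->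
  exists2 T : {set J}, T \subset G &
    #|T| <= q /\ 2 * #|[set i in Y | [disjoint M i & T]]| <= #|Y|.
Proof.
move=> hM.
suff main j : j <= q -> exists2 T : {set J}, T \subset G &
    #|T| <= j /\ (let u := #|[set i in Y | [disjoint M i & T]]| in
     u <= #|Y| /\ ((2 * u <= #|Y|) \/ (j * #|Y| <= 2 * q * (#|Y| - u)))).
  have [T TG [Tq [uY hu]]] := main q (leqnn _); exists T => //; split => //.
  case: hu => // hu.
  have [q0|q0] := posnP q; last by nia.
  have [Y0|] := posnP #|Y|.
    by move: uY; rewrite Y0 leqn0 => /eqP ->.
  by case/card_gt0P => i /hM[]; rewrite q0 mul0n leqn0 => /subset_leq_card MG /leq_trans h /eqP G0;
     have := h _ MG; rewrite G0.
elim: j => [|j IH] jq.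
  exists set0; rewrite ?sub0set // cards0; split=> //=; split; last by right.
  by apply: subset_leq_card; apply/subsetP => i; rewrite inE => /andP[].
have [T TG [Tj [uY hu]]] := IH (ltnW jq).
set Y' := [set i in Y | _] in uY hu.
have [hu2|hu2] := leqP (2 * #|Y'|) #|Y|.
  exists T => //; split; first exact: leqW.
  by split => //; left.
have [i| |h hG hh] := @hitting_step I J M Y' G q.
- by rewrite inE => /andP[/hM].
- by move: hu2; lia.
exists (h |: T); first by rewrite subUset sub1set hG.
split; first by rewrite cardsU1; case: (_ \in _); lia.
have sub : [set i in Y | [disjoint M i & h |: T]] = Y' :\: [set i in Y' | h \in M i].
  apply/setP => i; rewrite !inE; case: (i \in Y) => //=.
  rewrite ![[disjoint M i & _]]disjoint_sym -!setI_eq0 setIUl setU_eq0 !setI_eq0.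
  rewrite disjoints1; by case: (h \in M i); case: [disjoint _ & _].
rewrite /= sub cardsD (setIidPr _); last first.
  by apply/subsetP => i; rewrite inE => /andP[].
have hle : #|[set i in Y' | h \in M i]| <= #|Y'|.
  by apply: subset_leq_card; apply/subsetP => i; rewrite inE => /andP[].
split; first by lia.
right; case: hu => hu; first by lia.
move: hh hle hu hu2 uY.
set a := #|[set i in Y' | _]|; set u := #|Y'|; set w := #|Y|.
move=> hh hle hu hu2 uY.
rewrite (_ : w - (u - a) = (w - u) + a); last by lia.
by rewrite mulnDr mulSn; nia.
Qed.

Lemma hitting_set (I J : finType) (M : I -> {set J}) (Y : {set I})
    (G : {set J}) (q k : nat) :
  (forall i, i \in Y -> [/\ M i \subset G, 0 < #|M i| & #|G| <= q * #|M i|]) ->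
  exists2 T : {set J}, T \subset G &
    #|T| <= q * k /\ 2 ^ k * #|[set i in Y | [disjoint M i & T]]| <= #|Y|.
Proof.
move=> hM; elim: k => [|k [T TG [Tk hT]]].
  exists set0; rewrite ?sub0set // cards0 expn0 mul1n; split => //.
  by apply: subset_leq_card; apply/subsetP => i; rewrite inE => /andP[].
set Y' := [set i in Y | _] in hT.
have [i|T' TG' [Tq hT']] := @hitting_half I J M Y' G q.
  by rewrite inE => /andP[/hM].
exists (T :|: T'); first by rewrite subUset TG.
split; first by rewrite mulnS (leq_trans (leq_card_setU _ _)) // addnC leq_add.
rewrite (_ : [set i in Y | _] = [set i in Y' | [disjoint M i & T']]).
  by rewrite expnSr -mulnA (leq_trans _ hT) // leq_mul2l hT' orbT.
apply/setP => i; rewrite !inE -andbA; congr (_ && _).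
by rewrite ![[disjoint M i & _]]disjoint_sym -!setI_eq0 setIUl setU_eq0.
Qed.

(** * Shadows, walks and linked sets *)

Section CoverGraph.
Variables (V : finType) (cov : rel V).
Implicit Types (x y u v : V) (A B Z : {set V}).

Definition dn x := [set y | cov x y].
Definition up y := [set x | cov x y].
Definition shadow A := \bigcup_(x in A) dn x.
Definition ushadow B := \bigcup_(y in B) up y.

Lemma mem_up x y : (x \in up y) = (y \in dn x). Proof. by rewrite !inE. Qed.

Lemma shadowP A y : reflect (exists2 x, x \in A & y \in dn x) (y \in shadow A).
Proof. exact: bigcupP. Qed.

Lemma ushadowP B x : reflect (exists2 y, y \in B & y \in dn x) (x \in ushadow B).
Proof.
by apply: (iffP bigcupP) => -[y yB h]; exists y; move: h; rewrite // mem_up.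
Qed.

Lemma shadowS A B : A \subset B -> shadow A \subset shadow B.
Proof.
move=> /subsetP AB; apply/subsetP => y /shadowP[x /AB xB yx].
by apply/shadowP; exists x.
Qed.

Lemma shadowU A B : shadow (A :|: B) = shadow A :|: shadow B.
Proof. exact: bigcup_setU. Qed.

Lemma dn_sub_shadow A x : x \in A -> dn x \subset shadow A.
Proof. by move=> xA; apply: bigcup_sup. Qed.

Lemma exchange_shadow (R : nmodType) (w : V -> V -> R) A :
  (\sum_(x in A) \sum_(y in dn x) w x y =
   \sum_(y in shadow A) \sum_(x in up y :&: A) w x y)%R.
Proof.
rewrite (exchange_big_dep (mem (shadow A))) /=; last first.
  by move=> x y xA yx; apply/shadowP; exists x.
apply: eq_bigr => y _; apply: eq_bigl => x.
by rewrite in_setI mem_up andbC.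
Qed.

Definition adj u v := [|| u == v, cov u v | cov v u].

Lemma adj_refl u : adj u u. Proof. by rewrite /adj eqxx. Qed.

Lemma adj_sym u v : adj u v = adj v u.
Proof. by rewrite /adj eq_sym [cov u v || _]orbC. Qed.

Definition reach r u v :=
  exists p : seq V, [/\ path adj u p, size p = r & last u p = v].

Lemma reach0 u : reach 0 u u. Proof. by exists [::]. Qed.

Lemma reach1 u v : adj u v -> reach 1 u v.
Proof. by exists [:: v] => /=; rewrite andbT. Qed.

Lemma reach_trans r s u v w : reach r u v -> reach s v w -> reach (r + s) u w.
Proof.
move=> [p [pp sp lp]] [q [pq sq lq]]; exists (p ++ q).
by rewrite cat_path pp lp pq size_cat sp sq last_cat lp.
Qed.

Lemma reach_sym r u v : reach r u v -> reach r v u.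
Proof.
move=> [p [pp sp lp]]; exists (rev (belast u p)).
rewrite -lp rev_path size_rev size_belast; split => //.
  by rewrite (eq_path (e' := adj)) // => x y /=; rewrite adj_sym.
by case: p {pp sp lp} => [|x p] //=; rewrite rev_cons last_rcons.
Qed.

Lemma reach_refl r u : reach r u u.
Proof.
elim: r => [|r IH]; first exact: reach0.
exact: (reach_trans (reach1 (adj_refl u)) IH).
Qed.

Lemma reach_leq r s u v : r <= s -> reach r u v -> reach s u v.
Proof.
move=> /subnKC <- h; exact: reach_trans h (reach_refl _ _).
Qed.

Lemma reach_dn x y : y \in dn x -> reach 1 x y.
Proof. by rewrite inE => h; apply: reach1; rewrite /adj h orbT. Qed.

(* A closed detour of twice 2r+d steps adds each missing element of Z to the walk:
   otherwise the elements of A close to the visited part of Z would be a proper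
   part of A with no link of length d leaving it. *)
Lemma walk_cover v A Z r d :
  v \in A ->
  (forall B, B \subset A -> v \in B -> B != A ->
    exists x y, [/\ x \in B, y \in A :\: B & reach d x y]) ->
  (forall z, z \in Z -> exists2 a, a \in A & reach r z a) ->
  (forall a, a \in A -> exists2 z, z \in Z & reach r a z) ->
  exists p : seq V, [/\ path adj v p, size p = 2 * (2 * r + d) * #|Z| &
    {subset Z <= v :: p}].
Proof.
move=> vA conn ZA AZ; set R := 2 * r + d.
suff main j : j <= #|Z| -> exists Z' : {set V}, exists p : seq V,
    [/\ Z' \subset Z, #|Z'| = j, path adj v p, size p = 2 * R * j &
        {subset Z' <= v :: p}].
  have [Z' [p [Z'Z cZ' pp sp Zp]]] := main _ (leqnn _).
  exists p; split => //; suff <- : Z' = Z by [].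
  by apply/eqP; rewrite eqEcard Z'Z cZ' leqnn.
elim: j => [|j IH] jZ.
  exists set0, [::]; rewrite sub0set cards0 muln0; split => // x.
  by rewrite inE.
have [Z' [p [Z'Z cZ' pp sp Zp]]] := IH (ltnW jZ).
have [u [z [uZ zZ uz]]] : exists u z,
    [/\ u \in v |: Z', z \in Z :\: Z' & reach R u z].
  have /set0Pn[z0 z0Z] : Z :\: Z' != set0.
    by rewrite -card_gt0 cardsD (setIidPr Z'Z) cZ' subn_gt0.
  have [a0 a0A ra0] := ZA _ (subsetP (subsetDl _ _) _ z0Z).
  pose close_to a := [exists u in v |: Z', [exists q : r.-tuple V,
                    path adj a q && (last a q == u)]].
  have nearP a : reflect (exists2 u, u \in v |: Z' & reach r a u) (close_to a).
    apply: (iffP exists_inP) => -[u uZ h]; exists u => //.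
      by case/existsP: h => q /andP[pq /eqP lq]; exists q; rewrite size_tuple.
    case: h => q [pq sq lq]; apply/existsP.
    by exists (tcast sq (in_tuple q)); rewrite val_tcast /= pq lq eqxx.
  case: (boolP (close_to a0)) => [/nearP[u uZ au]|na0].
    exists u, z0; split => //; apply: (@reach_leq (r + r)); first by rewrite /R; lia.
    apply: reach_trans (reach_sym au) (reach_sym ra0).
  have [|||x [y [xB]]] := conn [set a in A | close_to a].
  - by apply/subsetP => a; rewrite inE => /andP[].
  - rewrite inE vA; apply/nearP; exists v; [exact: setU11|exact: reach_refl].
  - by apply: contraNneq na0 => E; move: a0A; rewrite -E inE => /andP[].
  rewrite !inE negb_and => /andP[ny yA] xy.
  move: ny; rewrite yA /= => ny.
  move: xB; rewrite inE => /andP[_ /nearP[u uZ xu]].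
  have [z zZ yz] := AZ _ yA; exists u, z; split => //.
    rewrite inE zZ andbT; apply: contra ny => zZ'.
    by apply/nearP; exists z => //; rewrite in_setU1 zZ' orbT.
  apply: (@reach_leq ((r + d) + r)); first by rewrite /R; lia.
  exact: reach_trans (reach_trans (reach_sym xu) xy) yz.
have up : u \in v :: p.
  by move: uZ; rewrite in_setU1 => /predU1P[->|/Zp]; rewrite // mem_head.
have [d1 [pd1 sd1 ld1]] := uz; have [d2 [pd2 sd2 ld2]] := reach_sym uz.
exists (z |: Z').
case/splitPl: up pp sp Zp => p1 p2 lp1; rewrite cat_path lp1 => /andP[pp1 pp2] sp Zp.
exists (p1 ++ d1 ++ d2 ++ p2); split.
- by rewrite subUset sub1set Z'Z andbT; move: zZ; rewrite inE => /andP[].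
- by move: zZ; rewrite inE cardsU1 cZ' => /andP[->].
- by rewrite !cat_path pp1 lp1 pd1 ld1 pd2 ld2.
- by rewrite !size_cat sd1 sd2; move: sp; rewrite size_cat; lia.
- move=> x; rewrite in_setU1 => /predU1P[->|/Zp].
    rewrite -ld1 -cat_cons mem_cat; apply/orP.
    case: d1 {pd1 sd1} ld1 => [|e d1] /= ld1; first by left; rewrite -lp1 mem_last.
    by right; rewrite -cat_cons mem_cat mem_last.
  by rewrite -!cat_cons !mem_cat => /orP[->|->]; rewrite ?orbT.
Qed.

Lemma card_walks v D m : (forall u, #|[set w | adj u w]| <= D) ->
  #|[set p : m.-tuple V | path adj v p]| <= D ^ m.
Proof.
move=> hD; elim: m v => [|m IH] v.
  by rewrite expn0 (leq_trans (max_card _)) // card_tuple.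
have sub : [set p : m.+1.-tuple V | path adj v p] \subset
    \bigcup_(w in [set w | adj v w])
      ((fun p : m.-tuple V => [tuple of w :: p]) @: [set p : m.-tuple V | path adj w p]).
  apply/subsetP => p; rewrite inE; case/tupleP: p => w p /= /andP[vw wp].
  by apply/bigcupP; exists w; rewrite ?inE //; apply: imset_f; rewrite inE.
apply: leq_trans (subset_leq_card sub) _.
apply: (@leq_trans (\sum_(w in [set w | adj v w]) D ^ m)).
  apply: leq_trans (_ : _ <= \sum_(w in [set w | adj v w])
     #|[set p : m.-tuple V | path adj w p]|) _; last by apply: leq_sum.
  elim/big_rec2: _ => [|w a B _ h]; first by rewrite cards0.
  rewrite (leq_trans (leq_card_setU _ _)) // leq_add // leq_imset_card //.
by rewrite sum_nat_const expnS leq_mul2r hD orbT.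
Qed.

Section Linked.
Variable J : finType.

(** [J] is a set of labels: several vertex sets, such as the slots of two certificates, are packed
    into one set of labelled vertices, to be visited by a single walk from [v]. *)
Definition linked v m (Z : {set J * V}) :=
  [exists p : m.-tuple V, path adj v p && [forall z in Z, z.2 \in v :: p]].

(** Choose the walk, then a set of labels at each of its m+1 vertices. *)
Lemma card_linked v D m : (forall u, #|[set w | adj u w]| <= D) ->
  #|[set Z | linked v m Z]| <= D ^ m * 2 ^ (#|J| * m.+1).
Proof.
move=> hD.
have sub : [set Z | linked v m Z] \subset
    \bigcup_(p in [set p : m.-tuple V | path adj v p])
      powerset (setX [set: J] [set x | x \in v :: p]).
  apply/subsetP => Z; rewrite inE => /existsP[p /andP[pp /forall_inP Zp]].
  apply/bigcupP; exists p; rewrite ?inE //; apply/subsetP => -[j x] /Zp /=.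
  by rewrite !inE.
apply: leq_trans (subset_leq_card sub) _.
apply: (@leq_trans (\sum_(p in [set p : m.-tuple V | path adj v p])
    2 ^ (#|J| * m.+1))); last first.
  by rewrite sum_nat_const leq_mul2r card_walks ?orbT.
elim/big_rec2: _ => [|p a B _ h]; first by rewrite cards0.
rewrite (leq_trans (leq_card_setU _ _)) // leq_add //.
rewrite card_powerset leq_exp2l // cardsX cardsT leq_mul2l; apply/orP; right.
rewrite cardsE (leq_trans (card_size _)) //= size_tuple //.
Qed.

Local Open Scope ring_scope.

(** At most 2^|J| 2^((b-1)s) linked sets have size s, so the weights 2^-(bs) leave a geometric
    series. The summand 1 in the exponent of the hypothesis provides its ratio 1/2. *)
Lemma sum_linked (F : realFieldType) v D R b : (forall u, (#|[set w | adj u w]| <= D)%N) ->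
  (D ^ R * 2 ^ (#|J| * R + 1) <= 2 ^ b)%N ->
  \sum_(Z : {set J * V} | linked v (R * #|Z|) Z) (2 ^- (b * #|Z|) : F) <= 2 ^+ (#|J| + 1).
Proof.
move=> hD hb.
pose N := #|{: J * V}|.
have cZ (Z : {set J * V}) : (#|Z| < N.+1)%N by rewrite ltnS max_card.
rewrite (partition_big (fun Z : {set J * V} => Ordinal (cZ Z)) xpredT) //=.
have geo m : \sum_(s < m) (2 ^- s : F) <= 2 - 2 * 2 ^- m.
  elim: m => [|m IH]; first by rewrite big_ord0 expr0 invr1; lra.
  rewrite big_ord_recr /= exprS invfM; set x := 2 ^- m in IH *; lra.
apply: (@le_trans _ _ (\sum_(s < N.+1) 2 ^+ #|J| * 2 ^- s)); last first.
  rewrite -mulr_sumr exprD expr1 ler_wpM2l ?exprn_ge0 //.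
  by rewrite (le_trans (geo _)) // gerBl mulr_ge0 // invr_ge0 exprn_ge0.
apply: ler_sum => s _.
apply: (@le_trans _ _ (\sum_(Z in [set Z | linked v (R * s) Z]) (2 ^- (b * s) : F))).
  rewrite [leLHS](eq_bigr (fun=> 2 ^- (b * s))); last by move=> Z /andP[_ /eqP <-].
  rewrite big_mkcond [leRHS]big_mkcond /=; apply: ler_sum => Z _.
  rewrite inE; case: andP => [[h /eqP <-] /=|_]; first by rewrite h.
  by case: ifP => // _; rewrite invr_ge0 exprn_ge0.
rewrite sumr_const -[leLHS]mulr_natl.
have pow k : 0 < (2 : F) ^+ k by rewrite exprn_gt0.
rewrite ler_pdivrMr // -mulrA mulrCA ler_pdivlMl ?pow //.
rewrite -!natrX -!natrM ler_nat.
apply: leq_trans (leq_mul (leqnn _) (card_linked v (R * s) hD)) _.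
have -> : (2 ^ s * (D ^ (R * s) * 2 ^ (#|J| * (R * s).+1)) =
    (D ^ R * 2 ^ (#|J| * R + 1)) ^ s * 2 ^ #|J|)%N.
  rewrite expnMn -!expnM mulnCA -!mulnA; congr (_ * _)%N.
  by rewrite -!expnD; congr (_ ^ _)%N; rewrite mulnDl mul1n mulnS mulnA; lia.
rewrite mulnC leq_mul2l expnM; apply/orP; right.
by case: (s : nat) => [|k]; rewrite ?expn0 // leq_exp2r.
Qed.
End Linked.
End CoverGraph.

(** * Containers from certificates *)

(** [a], [e], [a2], [a3] are the sizes of slots 0 to 3 of a certificate. Slots 0 and 1 are compared
    with [t] by way of [g <= 65 * n * t], and the factor b^2 I in [K] makes them small against
    t/b^2. The factor K b^2 in [p] does the same for the greedy covers in slots 2 and 3. *)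
Lemma certificate_arith n b t g I K p q a e a2 a3 :
  0 < n -> 0 < b -> 0 < I -> K = 100 * 100 * 100 * b ^ 2 * I ->
  p = 1120 * K * b ^ 2 -> K <= n -> n <= t -> g <= 65 * n * t ->
  q = 100 * g %/ n ^ 2 + 1 -> a <= q * I -> K * e <= n * a ->
  a2 * p <= 28 * K * t -> a3 * p <= 4 * t ->
  40 * b ^ 2 * (a + e + a2 + a3) <= 3 * t.
Proof.
move=> n0 b0 I0 hK hp Kn nt hg hq ha he h2 h3.
have b2 : 0 < b ^ 2 by rewrite expn_gt0 b0.
have K0 : 0 < K by rewrite hK; move: (b ^ 2) b2 => z z0; nia.
have a2t : 40 * b ^ 2 * a2 <= t.
  rewrite -(@leq_pmul2l (28 * K)) ?muln_gt0 ?K0 //.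
  by apply: leq_trans h2; rewrite hp; nia.
have a3t : 40 * b ^ 2 * a3 <= t.
  rewrite -(@leq_pmul2l 4) //; apply: leq_trans h3; rewrite hp; nia.
have qn : q * n ^ 2 <= 100 * g + n ^ 2.
  by rewrite hq mulnDl mul1n leq_add2r leq_trunc_div.
have qn' : q * n <= 66 * 100 * t.
  rewrite -(leq_pmul2l n0) (_ : n * (q * n) = q * n ^ 2); last by rewrite -mulnn; ring.
  apply: leq_trans qn _; rewrite -mulnn; nia.
have an : n * a <= 66 * 100 * t * I.
  apply: (@leq_trans (n * (q * I))); first by rewrite leq_mul2l ha orbT.
  by rewrite mulnA [n * q]mulnC leq_mul2r qn' orbT.
have ae : K * (a + e) <= 132 * 100 * t * I by nia.
have aet : 40 * b ^ 2 * (a + e) <= t.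
  rewrite -(@leq_pmul2l (100 * 132 * I)) ?muln_gt0 ?I0 //.
  apply: (@leq_trans (K * (a + e))); last by nia.
  rewrite hK; set z := b ^ 2 * (a + e) * I.
  rewrite (_ : 100 * 132 * I * (40 * b ^ 2 * (a + e)) = 100 * 132 * 40 * z); last by rewrite /z; ring.
  rewrite (_ : 100 * 100 * 100 * b ^ 2 * I * (a + e) = 100 * 100 * 100 * z); last by rewrite /z; ring.
  lia.
lia.
Qed.

(** [r] counts the part of the shadow not yet detected. If it is at least t/(4b), the container of
    size about g - r is small enough. Otherwise listing this part costs less than t/4 and cuts the
    container down to the closure, of size g - t. *)
Lemma container_arith n b t g K p s c f c' r :
  0 < n -> 0 < b -> 52 * 100 * K * p * b <= n -> 40 * b * n ^ 2 <= t ->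
  40 * b ^ 2 * s <= 3 * t -> f + r = g -> c' + t = g ->
  n * c <= n * f + 4 * (p * (28 * K * t + 4 * t)) ->
  0 < K ->
  (t <= 4 * b * r -> b * s + c + n ^ 2 <= g) /\
  (4 * b * r < t -> b * (s + r) + c' + n ^ 2 <= g).
Proof.
move=> n0 b0 hn hb hs hf hc' hc K0.
have hs' : 40 * b * (b * s) <= 3 * t by rewrite mulnA -[40 * b * b]mulnA mulnn.
split => h.
  have hc2 : n * (40 * b * c) <= n * (40 * b * f + t).
    rewrite mulnCA mulnDr [n * (40 * b * f)]mulnCA.
    apply: leq_trans (leq_mul (leqnn (40 * b)) hc) _; rewrite mulnDr leq_add2l.
    apply: (@leq_trans (52 * 100 * K * p * b * t)); last by rewrite leq_mul2r hn orbT.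
    have Kt : t <= K * t by rewrite leq_pmull.
    apply: (@leq_trans (40 * b * (4 * (p * (32 * (K * t)))))).
      by rewrite !leq_mul2l; apply/orP; right; apply/orP; right; apply/orP; right; lia.
    rewrite (_ : 40 * b * (4 * (p * (32 * (K * t)))) = 5120 * (K * p * b * t)); last by ring.
    rewrite (_ : 52 * 100 * K * p * b * t = 5200 * (K * p * b * t)); last by ring.
    by rewrite leq_mul2r orbC.
  move: hc2; rewrite leq_pmul2l // => hc2.
  rewrite -(@leq_pmul2l (40 * b)) ?muln_gt0 ?b0 // !mulnDr -hf mulnDr.
  rewrite (_ : 40 * b * r = 10 * (4 * b * r)); last by ring.
  lia.
rewrite -(@leq_pmul2l (40 * b)) ?muln_gt0 ?b0 // !mulnDr -hc' mulnDr.
have hr : 40 * b * (b * r) <= 10 * (b * t).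
  rewrite (_ : 40 * b * (b * r) = 10 * (b * (4 * b * r))); last by ring.
  by rewrite leq_mul2l /= leq_mul2l (ltnW h) orbT.
have tb : t <= b * t by rewrite leq_pmull.
rewrite (_ : 40 * b * t = 40 * (b * t)); last by ring.
lia.
Qed.

Section Container.
Variables (V : finType) (cov : rel V) (X : {set V}) (n : nat).
Notation dn := (dn cov).
Notation up := (up cov).
Notation shadow := (shadow cov).
Notation ushadow := (ushadow cov).
Notation reach := (reach cov).
Implicit Types (x y : V) (A B F S : {set V}).

(** * Edge weights: shadow, closure and slack *)

Lemma double_count (P B : {set V}) :
  \sum_(x in P) #|dn x :&: B| = \sum_(y in B) #|up y :&: P|.
Proof.
under eq_bigr do rewrite -sum1_card.
under [RHS]eq_bigr do rewrite -sum1_card.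
rewrite (exchange_big_dep (mem B)) /=; last by move=> x y _; rewrite inE => /andP[].
apply: eq_bigr => y yB; apply: eq_bigl => x.
by rewrite !inE [y \in B]yB andbT andbC.
Qed.

Hypothesis n_gt0 : 0 < n.
Hypothesis dn_le : forall x, x \in X -> #|dn x| <= n.
Hypothesis dn_ge : forall x, x \in X -> n <= 2 * #|dn x|.
Hypothesis up_le_dn : forall x y, x \in X -> y \in dn x -> #|up y| <= #|dn x|.

Lemma dn_neq0 x : x \in X -> exists y, y \in dn x.
Proof. by move=> /dn_ge xX; apply/card_gt0P; lia. Qed.

Lemma up_gt0 x y : y \in dn x -> 0 < #|up y|.
Proof. by move=> yx; apply/card_gt0P; exists x; rewrite mem_up. Qed.

Lemma up_le_n A y : A \subset X -> y \in shadow A -> #|up y| <= n.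
Proof.
move=> /subsetP AX /shadowP[x /AX xX yx].
exact: leq_trans (up_le_dn xX yx) (dn_le xX).
Qed.

(** For [A] inside [X], the largest subset of [X] with the same shadow; unlike [A], it can be
    recovered from the shadow. *)
Definition cl A := [set x in X | dn x \subset shadow A].

Lemma cl_sub A : cl A \subset X.
Proof. by apply/subsetP => x; rewrite inE => /andP[]. Qed.

Lemma sub_cl A : A \subset X -> A \subset cl A.
Proof.
move=> /subsetP AX; apply/subsetP => x xA.
by rewrite inE (AX _ xA) dn_sub_shadow.
Qed.

Lemma shadow_cl A : A \subset X -> shadow (cl A) = shadow A.
Proof.
move=> AX; apply/eqP; rewrite eqEsubset [X in _ && X]shadowS ?sub_cl // andbT.
by apply/bigcupsP => x; rewrite inE => /andP[].
Qed.

(** Every [y] splits a unit of mass evenly among the elements of [up y]; by [up_le_dn], every [x] of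
    [X] then receives at least 1. *)
Local Notation wt y := ((#|up y|)%:R^-1 : rat)%R.

Lemma sum_wt x : x \in X -> (1 <= \sum_(y in dn x) wt y)%R.
Proof.
move=> xX; have [y0 y0x] := dn_neq0 xX.
have d0 : 0 < #|dn x| by apply/card_gt0P; exists y0.
apply: (@le_trans _ _ (\sum_(y in dn x) (#|dn x|)%:R^-1)%R).
  rewrite sumr_const -[leRHS]mulr_natl divff // pnatr_eq0; lia.
apply: ler_sum => y yx; rewrite lef_pV2 ?posrE ?ltr0n ?(up_gt0 yx) //.
by rewrite ler_nat up_le_dn.
Qed.

Lemma wt_exchange S :
  (\sum_(x in S) \sum_(y in dn x) wt y =
   \sum_(y in shadow S) #|up y :&: S|%:R * wt y)%R.
Proof.
rewrite exchange_shadow; apply: eq_bigr => y _.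
by rewrite sumr_const mulr_natl.
Qed.

Lemma wt_ratio_le1 S y : y \in shadow S -> (#|up y :&: S|%:R * wt y <= 1)%R.
Proof.
move=> /shadowP[x _ yx]; rewrite ler_pdivrMr ?ltr0n ?(up_gt0 yx) // mul1r ler_nat.
by rewrite subset_leq_card ?subsetIl.
Qed.

Lemma card_le_wt S : S \subset X ->
  (#|S|%:R <= \sum_(y in shadow S) #|up y :&: S|%:R * wt y)%R.
Proof.
move=> /subsetP SX; rewrite -wt_exchange -sum1_card natr_sum.
by apply: ler_sum => x /SX /sum_wt.
Qed.

Lemma card_le_shadow S : S \subset X -> #|S| <= #|shadow S|.
Proof.
move=> SX; rewrite -(ler_nat rat) (le_trans (card_le_wt SX)) //.
rewrite -[leRHS]mulr1 mulr_natl -sumr_const.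
by apply: ler_sum => y; apply: wt_ratio_le1.
Qed.

Lemma card_cl_le A : A \subset X -> #|cl A| <= #|shadow A|.
Proof. by move=> AX; rewrite -(shadow_cl AX) card_le_shadow ?cl_sub. Qed.

(** The closure receives at least |cl A| of the total mass |shadow A|. At most the difference flows
    to elements outside it, and every such edge carries at least 1/n. *)
Lemma sum_out A : A \subset X ->
  \sum_(y in shadow A) #|up y :\: cl A| <= n * (#|shadow A| - #|cl A|).
Proof.
move=> AX; rewrite -(ler_nat rat) natr_sum natrM natrB ?card_cl_le //.
apply: (@le_trans _ _ (\sum_(y in shadow A)
    (n%:R * (1 - #|up y :&: cl A|%:R * wt y)))%R).
  apply: ler_sum => y yA.
  have u0 : (0 < (#|up y|)%:R :> rat)%R.
    by rewrite ltr0n; have /shadowP[x _ yx] := yA; apply: up_gt0 yx.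
  have un : (#|up y|%:R <= n%:R :> rat)%R by rewrite ler_nat (up_le_n AX yA).
  have e : (#|up y|%:R = #|up y :&: cl A|%:R + #|up y :\: cl A|%:R :> rat)%R.
    by rewrite -natrD cardsID.
  rewrite -[X in (1 - X)%R]/(_ / _)%R.
  have -> : (1 - #|up y :&: cl A|%:R / #|up y|%:R = #|up y :\: cl A|%:R / #|up y|%:R :> rat)%R.
    by rewrite -[X in (X - _)%R](divff (lt0r_neq0 u0)) -mulrBl {1}e addrC addKr.
  rewrite mulrCA mulrC -{1}[(_%:R)%R]mul1r ler_wpM2r // ler_pdivlMr // mul1r //.
rewrite -mulr_sumr ler_wpM2l // big_split /= sumr_const lerD2l sumrN lerN2.
by rewrite -(shadow_cl AX) card_le_wt ?cl_sub.
Qed.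

(** An element of [F] contributes at most 1 to the mass received by [S]; any other one sends at most
    4/n along each edge. *)
Lemma card_le_slack S F : S \subset X ->
  (forall y, y \in shadow S -> n <= 4 * #|up y|) ->
  n * #|S| <= n * #|F| + 4 * \sum_(y in shadow S :\: F) #|up y :&: S|.
Proof.
move=> SX hup; rewrite -(ler_nat rat) natrD !natrM natr_sum.
have n0 : (0 <= n%:R :> rat)%R by [].
apply: le_trans (ler_wpM2l n0 (card_le_wt SX)) _.
rewrite (big_setID F) /= mulrDr lerD //.
  rewrite ler_wpM2l // (@le_trans _ _ (#|shadow S :&: F|%:R)%R) //.
    rewrite -[leRHS]mulr1 mulr_natl -sumr_const.
    by apply: ler_sum => y; rewrite inE => /andP[/wt_ratio_le1].
  by rewrite ler_nat subset_leq_card // subsetIr.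
rewrite !mulr_sumr; apply: ler_sum => y; rewrite inE => /andP[_ yS].
have u0 : (0 < (#|up y|)%:R :> rat)%R.
  by rewrite ltr0n; have /shadowP[x _ yx] := yS; apply: up_gt0 yx.
rewrite mulrA ler_pdivrMr // mulrAC ler_wpM2r // -natrM ler_nat; exact: hup.
Qed.

(* A certificate s for A consists of five sets. Slots 0, 1 and 2 are sets T0, E, T2
   such that (up T0 \ E) u T2 lies in the closure of A, so that cert_shadow s is
   contained in the shadow of A; slot 3 lists elements outside that shadow; slot 4
   is the part of the shadow which is still missing, when it is small enough to be
   listed. In mode 0 the certificate lists A itself, in slot 2. *)
Definition cert_shadow (s : 'I_5 -> {set V}) :=
  shadow (ushadow (s (inord 0)) :\: s (inord 1) :|: s (inord 2)).

(** The psi-approximation of the container method: elements with fewer than [p] lower neighbours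
    outside the detected part of the shadow. Slot 3 lies outside the true shadow, so nothing above
    it belongs to [A]. *)
Definition psi_container p s :=
  [set x in X | #|dn x :\: cert_shadow s| < p] :\: ushadow (s (inord 3)).

(** In mode 2, an element with at least [p] upper neighbours in the psi-container is recognized as
    lying in the shadow. Slot 4 supplies the rest of the shadow, and the container becomes the
    closure itself. *)
Definition container p (i : 'I_3) s :=
  match nat_of_ord i with
  | 0 => s (inord 2)
  | 1 => psi_container p s
  | _ => [set x in X | dn x \subset cert_shadow s
            :|: [set y | p <= #|up y :&: psi_container p s|] :|: s (inord 4)]
  end.

(** Closeness in both directions is what [walk_cover] needs to route a walk through the certificate
    when [A] is connected by short links. *)
Definition close_to (s : 'I_5 -> {set V}) A :=
  (forall j z, z \in s j -> exists2 a, a \in A & reach 3 z a) /\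
  (forall a, a \in A -> exists j, exists2 z, z \in s j & reach 3 a z).

Definition mk5 (l : seq {set V}) (j : 'I_5) : {set V} := nth set0 l j.

Lemma mk5E l k : k < 5 -> mk5 l (inord k) = nth set0 l k.
Proof. by move=> k5; rewrite /mk5 inordK. Qed.

Lemma sum_mk5 a0 a1 a2 a3 a4 :
  \sum_j #|mk5 [:: a0; a1; a2; a3; a4] j| = #|a0| + #|a1| + #|a2| + #|a3| + #|a4|.
Proof. by rewrite !big_ord_recl big_ord0 /mk5 /= !addnA addn0. Qed.

Lemma mk5P (P : V -> Prop) (a0 a1 a2 a3 a4 : {set V}) :
  {in a0, forall z, P z} -> {in a1, forall z, P z} -> {in a2, forall z, P z} ->
  {in a3, forall z, P z} -> {in a4, forall z, P z} ->
  forall j z, z \in mk5 [:: a0; a1; a2; a3; a4] j -> P z.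
Proof.
move=> h0 h1 h2 h3 h4 [[|[|[|[|[|//]]]]] ?] z; rewrite /mk5 /=;
  [exact: h0|exact: h1|exact: h2|exact: h3|exact: h4].
Qed.

Lemma reach_dn1 x y : y \in dn x -> reach 1 y x.
Proof. by move=> /reach_dn /reach_sym. Qed.

Lemma reach_shadow A y : y \in shadow A -> exists2 a, a \in A & reach 1 y a.
Proof. by case/shadowP => a aA ya; exists a => //; apply: reach_dn1. Qed.

Lemma reach_cl A x : x \in cl A -> exists2 a, a \in A & reach 2 x a.
Proof.
rewrite inE => /andP[/dn_neq0[y yx] /subsetP/(_ _ yx)/reach_shadow[a aA ya]].
by exists a => //; apply: reach_trans (reach_dn yx) ya.
Qed.

(** * Certificates for small sets, high layers and middle layers *)

Lemma dn_meets x F p : x \in X -> 2 * p <= n -> #|dn x :\: F| < p ->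
  exists y, y \in dn x :&: F.
Proof.
move=> xX pn xp; apply/card_gt0P; have := dn_ge xX; rewrite -(cardsID F (dn x)).
by move: #|_ :&: _| xp => i; move: #|_ :\: _| => d; clear -pn; lia.
Qed.

(** Listing [A] costs b|A|, its container is [A] itself, and both together take at most half of the
    shadow. *)
Lemma container_small A b p : A \subset X ->
  2 * (b + 1) * #|A| <= #|shadow A| ->
  exists (i : 'I_3) s, [/\ close_to s A, A \subset container p i s &
    b * \sum_j #|s j| + #|container p i s| + #|shadow A| %/ 4 <= #|shadow A|].
Proof.
move=> AX hA; exists (inord 0), (mk5 [:: set0; set0; A; set0; set0]).
rewrite /container inordK // mk5E // sum_mk5 !cards0; split => //.
  split; last by move=> a aA; exists (inord 2), a; rewrite ?mk5E //; apply: reach_refl.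
  by apply: mk5P => z; rewrite ?inE // => zA; exists z => //; apply: reach_refl.
rewrite !addn0 !add0n -[X in _ + X + _ <= _]mul1n -mulnDl.
have := leq_trunc_div #|shadow A| 4; lia.
Qed.

(** Where up-degrees are at most half of the down-degrees, the expansion is by a constant factor. A
    single greedy cover, of at most 24 g/n members, is then affordable. *)
Lemma container_top A b p : A \subset X ->
  (forall x y, x \in X -> y \in dn x -> 2 * #|up y| <= #|dn x|) ->
  p = n %/ 16 -> 32 <= n -> 500 * b <= n ->
  exists (i : 'I_3) s, [/\ close_to s A, A \subset container p i s &
    b * \sum_j #|s j| + #|container p i s| + #|shadow A| %/ 4 <= #|shadow A|].
Proof.
move=> AX up2 hp n32 hb; set g := #|shadow A|.
have p0 : 0 < p by rewrite hp; lia.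
have [T TA [Tp hT]] := greedy_cover dn A (shadow A) p0.
exists (inord 1), (mk5 [:: set0; set0; T; set0; set0]).
set s := mk5 _; set F := shadow T.
have FG : F \subset shadow A by rewrite shadowS.
have cE : container p (inord 1) s = [set x in X | #|dn x :\: F| < p].
  rewrite /container inordK // /psi_container /cert_shadow /s !mk5E //=.
  by rewrite /ushadow big_set0 set0D set0U setD0.
have cov_dn x : x \in A -> #|dn x :\: F| < p.
  move=> xA; apply: leq_ltn_trans (hT _ xA); rewrite subset_leq_card // setSD //.
  by rewrite subsetI subxx dn_sub_shadow.
split.
- split.
    apply: mk5P => z; rewrite ?inE // => /(subsetP TA) zA.
    by exists z => //; apply: reach_refl.
  move=> a aA; exists (inord 2).
  have [y /setIP[ya /shadowP[z zT yz]]] : exists y, y \in dn a :&: F.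
    by apply: dn_meets (cov_dn _ aA); [exact: (subsetP AX)|rewrite hp; lia].
  exists z; rewrite /s ?mk5E //; apply: (@reach_leq _ _ 2) => //.
  exact: reach_trans (reach_dn ya) (reach_dn1 yz).
- by rewrite cE; apply/subsetP => x xA; rewrite inE (subsetP AX _ xA) cov_dn.
rewrite cE sum_mk5 !cards0 !addn0 !add0n; set S := [set x in X | _].
have SX : S \subset X by apply/subsetP => x; rewrite inE => /andP[].
(* At least 7/8 of the lower neighbours of an [x] in [S] lie in [F], and each has weight at least
   2/|dn x|; so [x] receives at least 7/4 from [F]. *)
have cS : 7 * #|S| <= 4 * g.
  rewrite -(ler_nat rat) !natrM.
  have h1 : (7 / 4 * #|S|%:R <= \sum_(x in S) \sum_(y in dn x :&: F) (#|up y|%:R^-1 : rat))%R.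
    rewrite mulr_natr -sumr_const; apply: ler_sum => x; rewrite inE => /andP[xX xp].
    have d0 : (0 < #|dn x|%:R :> rat)%R by rewrite ltr0n; have := dn_ge xX; lia.
    apply: (@le_trans _ _ (\sum_(y in dn x :&: F) (2 / #|dn x|%:R))%R).
      rewrite sumr_const -[leRHS]mulr_natl mulrA ler_pdivlMr //.
      have h : 7 * #|dn x| <= 8 * #|dn x :&: F|.
        by have := dn_ge xX; rewrite -(cardsID F (dn x)); lia.
      move: h; rewrite -(ler_nat rat) !natrM; lra.
    apply: ler_sum => y /setIP[yx _].
    have u0 : (0 < #|up y|%:R :> rat)%R by rewrite ltr0n (up_gt0 yx).
    rewrite ler_pdivrMr // ler_pdivlMl // mulrC -natrM ler_nat.
    exact: up2 xX yx.
  have h2 : (\sum_(x in S) \sum_(y in dn x :&: F) (#|up y|%:R^-1 : rat) <= #|F|%:R)%R.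
    rewrite (exchange_big_dep (mem F)) /=; last by move=> x y _ /setIP[].
    rewrite -[leRHS]mulr1 mulr_natl -sumr_const; apply: ler_sum => y yF.
    apply: (@le_trans _ _ (\sum_(x in up y) (#|up y|%:R^-1))%R).
      rewrite big_mkcond [leRHS]big_mkcond; apply: ler_sum => x _ /=.
      rewrite mem_up in_setI; case: (y \in dn x) => /=; last by rewrite andbF.
      by case: ifP => _ //; rewrite invr_ge0.
    rewrite sumr_const -[leLHS]mulr_natl; have [->|u0] := posnP #|up y|.
      by rewrite mul0r.
    by rewrite divff // pnatr_eq0 -lt0n.
  have h3 : (#|F|%:R <= g%:R :> rat)%R by rewrite ler_nat subset_leq_card.
  lra.
have hT24 : n * #|T| <= 24 * g.
  have : n <= 24 * p by rewrite hp; lia.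
  move=> /(leq_mul (leqnn #|T|)); rewrite -/g in Tp; lia.
have hbT : 500 * (b * #|T|) <= 24 * g.
  by apply: leq_trans hT24; rewrite mulnA leq_mul2r hb orbT.
have := leq_trunc_div g 4; lia.
Qed.

Section Middle.
Hypothesis up_ge : forall x y, x \in X -> y \in dn x -> n <= 4 * #|up y|.
Hypothesis codeg : forall x x', x \in X -> x' \in X -> x != x' ->
  #|dn x :&: dn x'| <= 1.

(* Most elements y of the shadow of A have about n^2 well-behaved elements of the
   shadow at distance two through the closure of A; T is a hitting set for these
   neighbourhoods, and it is smaller than the shadow by a factor n^2 up to
   logarithms. *)
Lemma approx_hitting A K q k : A \subset X -> 0 < K -> 12 <= n ->
  100 * #|shadow A| <= q * n ^ 2 ->
  exists2 T : {set V}, T \subset shadow A &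
  [/\ #|T| <= q * k,
      K * #|ushadow T :\: cl A| <= n * #|T| &
      exists2 u, 2 ^ k * u <= #|shadow A| &
      #|shadow A :\: shadow (ushadow T :&: cl A)|
        <= 27 * K * (#|shadow A| - #|cl A|) + u].
Proof.
move=> AX K0 n12 hq; set G := shadow A; set C := cl A.
set t := #|G| - #|C|.
have CX : C \subset X := cl_sub A.
have sG : shadow C = G by apply: shadow_cl.
have Cdn x : x \in C -> dn x \subset G by rewrite inE => /andP[].
have hout : \sum_(y in G) #|up y :\: C| <= n * t by apply: sum_out.
(* Almost all upper neighbours of a good element lie in the closure. By [sum_out], at most K t
   elements of the shadow are not good. *)
pose Good := [set y in G | K * #|up y :\: C| <= n].
have GoodG : Good \subset G by apply/subsetP => y; rewrite inE => /andP[].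
pose Bad := G :\: Good.
have cBad : #|Bad| <= K * t.
  rewrite -(leq_pmul2l n_gt0) mulnCA (leq_trans _ (leq_mul (leqnn K) hout)) //.
  rewrite mulnC -sum_nat_const big_distrr /=.
  rewrite [leqRHS](big_setID Bad) /= (setIidPr (subsetDl _ _)) (leq_trans _ (leq_addr _ _)) //.
  apply: leq_sum => y; rewrite !inE => /andP[+ yG]; rewrite yG /= -ltnNge; exact: ltnW.
have upn y : y \in G -> #|up y| <= n by apply: up_le_n.
(* Members of the closure with few good lower neighbours; they are counted by their many edges down
   to [Bad]. *)
pose Poor := [set x in C | 4 * #|dn x :&: Good| < n].
have PoorC : Poor \subset C by apply/subsetP => x; rewrite inE => /andP[].
have cPoor : #|Poor| <= 4 * K * t.
  have h1 : n * #|Poor| <= 4 * \sum_(x in Poor) #|dn x :&: Bad|.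
    rewrite mulnC -sum_nat_const big_distrr /=; apply: leq_sum => x.
    rewrite inE => /andP[xC lt]; have := dn_ge (subsetP CX _ xC).
    have -> : dn x :&: Bad = dn x :\: Good.
      by rewrite setIDA (setIidPl (Cdn _ xC)).
    by rewrite -(cardsID Good (dn x)); lia.
  have h2 : \sum_(x in Poor) #|dn x :&: Bad| <= n * #|Bad|.
    rewrite double_count mulnC -sum_nat_const; apply: leq_sum => y.
    rewrite inE => /andP[_ yG]; rewrite (leq_trans _ (upn _ yG)) //.
    by rewrite subset_leq_card // subsetIl.
  by rewrite -(leq_pmul2l n_gt0); nia.
(* Of the at least n/4 upper neighbours of any other [y], more than 3n/16 lie outside the closure or
   in [Poor]. This bounds their number by 16(1+4K)t/3, which is at most 27Kt. *)
pose Great := [set y in G | n <= 16 * #|up y :&: (C :\: Poor)|].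
have cNG : #|G :\: Great| <= 27 * K * t.
  have h1 : 3 * n * #|G :\: Great| <=
      16 * (\sum_(y in G) #|up y :\: C| + \sum_(y in G :\: Great) #|up y :&: Poor|).
    rewrite [X in 16 * (X + _)](big_setID (G :\: Great)) /= (setIidPr (subsetDl _ _)).
    apply: (@leq_trans (16 * (\sum_(y in G :\: Great) (#|up y :\: C| + #|up y :&: Poor|)))).
      rewrite mulnC -sum_nat_const big_distrr /=; apply: leq_sum => y.
      rewrite !inE => /andP[+ yG]; rewrite yG /= -ltnNge => lt.
      have [x xC yx] : exists2 x, x \in C & y \in dn x by apply/shadowP; rewrite sG.
      have := up_ge (subsetP CX _ xC) yx.
      rewrite -(cardsID C (up y)) -(cardsID Poor (up y :&: C)) -setIA.
      rewrite (setIidPr PoorC) -setIDA; lia.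
    rewrite big_split /=; lia.
  have h2 : \sum_(y in G :\: Great) #|up y :&: Poor| <= n * #|Poor|.
    rewrite -double_count mulnC -sum_nat_const; apply: leq_sum => x xP.
    rewrite (leq_trans _ (dn_le (subsetP CX _ (subsetP PoorC _ xP)))) //.
    by rewrite subset_leq_card // subsetIl.
  have h3 : n * (3 * #|G :\: Great|) <= n * (16 * (t + 4 * K * t)) by nia.
  by move: h3; rewrite leq_pmul2l // => h3; nia.
pose M y := Good :&: shadow (up y :&: C).
(* At least n/16 upper neighbours have at least n/4 good elements below each. By [codeg] these
   overlap at most in [y], and [12 <= n] pays for leaving out [y]. *)
have cM y : y \in Great -> n ^ 2 <= 100 * #|M y|.
  rewrite inE => /andP[yG]; set Rch := up y :&: _ => hR.
  pose B := M y :\ y.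
  have h1 : n * #|Rch| <= 4 * \sum_(x in Rch) (#|dn x :&: B| + 1).
    rewrite mulnC -sum_nat_const big_distrr /=; apply: leq_sum => x.
    rewrite in_setI mem_up in_setD => /and3P[yx + xC]; rewrite inE xC /= -leqNgt => /leq_trans -> //.
    rewrite leq_mul2l /= addn1; apply: leq_trans (_ : _ <= #|y |: (dn x :&: B)|) _.
      apply: subset_leq_card; apply/subsetP => z; rewrite in_setI => /andP[zx zG].
      rewrite in_setU1; case: eqP => //= /eqP zy.
      rewrite in_setI zx in_setD1 zy in_setI zG /=; apply/shadowP; exists x => //.
      by rewrite in_setI xC mem_up yx.
    by rewrite cardsU1; case: (_ \in _); lia.
  have h2 : \sum_(x in Rch) #|dn x :&: B| <= #|B|.
    rewrite double_count -[leqRHS]sum1_card; apply: leq_sum => z.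
    rewrite in_setD1 => /andP[zy _]; rewrite leqNgt; apply/negP => /card_gt1P[x [x' [+ + xx']]].
    rewrite !in_setI !mem_up => /andP[zx /andP[yx]] /setDP[xC _].
    move=> /andP[zx' /andP[yx']] /setDP[xC' _].
    have := codeg (subsetP CX _ xC) (subsetP CX _ xC') xx'.
    rewrite leqNgt => /negP; apply; apply/card_gt1P.
    by exists z, y; rewrite !in_setI zx zx' yx yx'.
  have h3 : #|B| <= #|M y| by rewrite subset_leq_card // subsetDl.
  move: h1; rewrite big_split /= sum1_card => h1.
  rewrite -mulnn; nia.
have [y|T TGood [Tk hT]] := @hitting_set V V M Great Good q k.
  move=> yG; have h := cM _ yG; split; first exact: subsetIl.
    by move: h; rewrite -mulnn; nia.
  have h' : #|Good| <= #|G| := subset_leq_card GoodG.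
  rewrite -(@leq_pmul2l 100) // mulnCA.
  apply: leq_trans (leq_mul (leqnn q) h).
  by rewrite (leq_trans _ hq) // leq_mul2l h' orbT.
exists T; first exact: subset_trans TGood GoodG.
split => //.
  apply: (@leq_trans (\sum_(z in T) K * #|up z :\: C|)).
    rewrite -big_distrr leq_mul2l /=; apply/orP; right.
    rewrite /ushadow (big_morph (fun B : {set V} => B :\: C) (fun _ _ => setDUl _ _ _) (set0D _)).
    elim/big_rec2: _ => [|z a B _ h]; first by rewrite cards0.
    by rewrite (leq_trans (leq_card_setU _ _)) // leq_add.
  rewrite mulnC -sum_nat_const; apply: leq_sum => z /(subsetP TGood).
  by rewrite inE => /andP[].
exists #|[set i in Great | [disjoint M i & T]]|.
  rewrite (leq_trans hT) // subset_leq_card //.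
  by apply/subsetP => y; rewrite inE => /andP[].
apply: leq_trans (leq_add cNG (leqnn _)).
apply: leq_trans (leq_card_setU _ _); apply: subset_leq_card.
apply/subsetP => y; rewrite in_setD => /andP[nF yG].
rewrite in_setU in_setD yG andbT; case: (boolP (y \in Great)) => //= yGr.
rewrite inE yGr /=; apply: contraNT nF => /pred0Pn[z /andP[/= zM zT]].
move: zM; rewrite in_setI => /andP[_ /shadowP[x]].
rewrite in_setI mem_up => /andP[yx xC] zx.
apply/shadowP; exists x => //; rewrite in_setI xC andbT.
by apply/ushadowP; exists z.
Qed.

(** [T2] greedily covers the rest of the shadow, so that members of the closure have fewer than [p]
    undetected lower neighbours. [S0] has at most 4t elements outside the closure, as each sends at
    least n/4 edges into the shadow and [sum_out] bounds these edges. [T3] removes enough of them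
    that elements outside the shadow have fewer than [p] upper neighbours in [S1]; this keeps [F2]
    inside the shadow. *)
Lemma approx_psi A F' p m : A \subset X -> 0 < p -> 4 * p <= n ->
  F' \subset shadow A -> #|shadow A :\: F'| <= m ->
  exists T2 T3 : {set V},
  let F := F' :|: shadow T2 in
  let S0 := [set x in X | #|dn x :\: F| < p] in
  let S1 := S0 :\: ushadow T3 in
  let F2 := F :|: [set y | p <= #|up y :&: S1|] in
  [/\ T2 \subset cl A, #|T2| * p <= m,
      #|T3| * p <= 4 * (#|shadow A| - #|cl A|) &
      (forall w, w \in T3 -> exists2 x, x \in S0 & w \in dn x)] /\
  [/\ cl A \subset S1, F2 \subset shadow A &
      n * #|S1| <= n * #|F2| + 4 * (p * (m + 4 * (#|shadow A| - #|cl A|)))].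
Proof.
move=> AX p0 pn F'G hm; set G := shadow A; set C := cl A; set t := #|G| - #|C|.
have CX : C \subset X := cl_sub A.
have sG : shadow C = G by apply: shadow_cl.
have Cdn x : x \in C -> dn x \subset G by rewrite inE => /andP[].
have hout : \sum_(y in G) #|up y :\: C| <= n * t by apply: sum_out.
have [T2 T2C [T2p hT2]] := greedy_cover dn C (G :\: F') p0.
set F := F' :|: shadow T2.
have FG : F \subset G by rewrite subUset F'G -sG shadowS.
set S0 := [set x in X | #|dn x :\: F| < p].
have CS0 : C \subset S0.
  apply/subsetP => x xC; rewrite inE (subsetP CX _ xC) /=.
  apply: leq_ltn_trans (hT2 _ xC); apply: subset_leq_card; apply/subsetP => y.
  rewrite !(in_setI, in_setD, in_setU) negb_or => /andP[/andP[-> ->] yx].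
  by rewrite yx (subsetP (Cdn _ xC) _ yx).
have cS0 : #|S0 :\: C| <= 4 * t.
  rewrite -(leq_pmul2l n_gt0) mulnCA.
  apply: leq_trans (leq_mul (leqnn 4) hout).
  apply: (@leq_trans (4 * \sum_(x in S0 :\: C) #|dn x :&: G|)).
    rewrite mulnC -sum_nat_const big_distrr /=; apply: leq_sum => x.
    case/setDP; rewrite inE => /andP[xX lt] _.
    have := dn_ge xX; rewrite -(cardsID F (dn x)).
    have : #|dn x :&: F| <= #|dn x :&: G| by rewrite subset_leq_card // setIS.
    lia.
  rewrite double_count leq_mul2l /=; apply: leq_sum => y _.
  by rewrite subset_leq_card // setIDA setSD // subsetIl.
pose Y := [set y | (y \notin G) && (up y :&: S0 != set0)].
have [T3 T3Y [T3p hT3]] := greedy_cover up Y (S0 :\: C) p0.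
set S1 := S0 :\: ushadow T3.
have upC y x : y \notin G -> x \in up y -> x \notin C.
  move=> yG; rewrite mem_up => yx; apply: contra yG => xC.
  exact: (subsetP (Cdn _ xC)).
have CS1 : C \subset S1.
  apply/subsetP => x xC; rewrite in_setD (subsetP CS0 _ xC) andbT.
  apply/negP => /ushadowP[y /(subsetP T3Y)]; rewrite inE => /andP[yG _].
  by rewrite -(mem_up cov) => /(upC _ _ yG); rewrite xC.
have hS1 y : y \notin G -> #|up y :&: S1| < p.
  move=> yG; case: (eqVneq (up y :&: S0) set0) => [e|ne].
    rewrite (_ : _ :&: _ = set0) ?cards0 //; apply/eqP.
    by rewrite -subset0 -e setIS // subsetDl.
  have yY : y \in Y by rewrite inE yG ne.
  apply: leq_ltn_trans (hT3 _ yY); apply: subset_leq_card; apply/subsetP => x.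
  rewrite !(in_setI, in_setD) => /andP[xy /andP[-> ->]].
  by rewrite xy (upC _ _ yG xy).
set F2 := F :|: [set y | p <= #|up y :&: S1|].
have F2G : F2 \subset G.
  rewrite subUset FG; apply/subsetP => y; rewrite inE.
  by apply: contraTT => /hS1; rewrite ltnNge.
exists T2, T3; split.
  split => //; [exact: leq_trans T2p hm|exact: leq_trans T3p cS0|].
  move=> w /(subsetP T3Y); rewrite inE => /andP[_ /set0Pn[x]].
  by rewrite in_setI mem_up => /andP[wx xS0]; exists x.
split => //.
have S1X : S1 \subset X.
  by apply/subsetP => x /setDP[]; rewrite inE => /andP[].
apply: leq_trans (card_le_slack F2 S1X _) _.
  by move=> y /shadowP[x /(subsetP S1X) xX yx]; apply: up_ge yx.
rewrite leq_add2l leq_mul2l /= mulnDr.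
(* Elements of the shadow outside [F2] have fewer than [p] upper neighbours in [S1]. Outside the
   shadow, edges are counted from the at most 4t elements of [S0 :\: C], each with fewer than [p]
   lower neighbours outside [F]. *)
rewrite (big_setID G) /= leq_add //.
  apply: (@leq_trans (\sum_(y in G :\: F2) p)).
    rewrite [leqRHS](big_setID (shadow S1)) /= (leq_trans _ (leq_addr _ _)) //.
    rewrite (_ : (G :\: F2) :&: shadow S1 = (shadow S1 :\: F2) :&: G); last first.
      by apply/setP => y; rewrite !(in_setI, in_setD); do !case: (_ \in _).
    apply: leq_sum => y; rewrite in_setI in_setD => /andP[/andP[+ _] _].
    by rewrite in_setU negb_or => /andP[_]; rewrite inE -ltnNge => /ltnW.
  rewrite sum_nat_const mulnC leq_mul2l (leq_trans _ hm) ?orbT //.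
  by apply: subset_leq_card; rewrite setDS // /F2 /F -setUA subsetUl.
apply: (@leq_trans (\sum_(y in shadow S1 :\: F2 :\: G) #|up y :&: (S0 :\: C)|)).
  apply: leq_sum => y; rewrite in_setD => /andP[yG _].
  apply: subset_leq_card; apply/subsetP => x.
  rewrite !(in_setI, in_setD) => /andP[xy /andP[_ ->]].
  by rewrite xy (upC _ _ yG xy).
rewrite -double_count (leq_trans _ (leq_mul (leqnn p) cS0)) //.
rewrite mulnC -sum_nat_const; apply: leq_sum => x.
case/setDP; rewrite inE => /andP[_ /ltnW + _]; apply: leq_trans.
apply: subset_leq_card; apply/subsetP => y.
rewrite !(in_setI, in_setD, in_setU) !negb_or.
by move=> /andP[-> /andP[_ /andP[/andP[/andP[-> ->]]]]].
Qed.

Lemma container_middle A b I K p : A \subset X -> 12 <= n -> 0 < b -> 0 < I ->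
  K = 100 * 100 * 100 * b ^ 2 * I -> p = 1120 * K * b ^ 2 ->
  52 * 100 * K * p * b <= n -> 65 * n <= 2 ^ I ->
  40 * b * n ^ 2 <= #|shadow A| - #|cl A| ->
  #|shadow A| <= 65 * n * (#|shadow A| - #|cl A|) ->
  exists (i : 'I_3) s, [/\ close_to s A, A \subset container p i s &
    b * \sum_j #|s j| + #|container p i s| + n ^ 2 <= #|shadow A|].
Proof.
move=> AX n12 b0 I0 hK hp hn hI ht hg.
set g := #|shadow A| in ht hg *; set C := cl A in ht hg *; set t := g - #|C| in ht hg *.
have K0 : 0 < K.
  have : 0 < b ^ 2 by rewrite expn_gt0 b0.
  by rewrite hK; move: (b ^ 2) => z z0; nia.
have p0 : 0 < p.
  have : 0 < b ^ 2 by rewrite expn_gt0 b0.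
  by rewrite hp; move: (b ^ 2) => z z0; nia.
have Kn : K <= n.
  apply: leq_trans hn; have : K <= K * (p * b) by rewrite leq_pmulr // muln_gt0 p0.
  lia.
have pn : 4 * p <= n.
  apply: leq_trans hn; have : p <= p * (K * b) by rewrite leq_pmulr // muln_gt0 K0.
  lia.
have pn2 : 2 * p <= n by apply: leq_trans pn; rewrite leq_mul2r orbT.
(* The ratio of g to a neighbourhood of n^2/100 elements, rounded up. After [I] halvings at most
   g/2^I elements are unhit, and this is at most [t] because [65 * n <= 2 ^ I]. *)
pose q := 100 * g %/ n ^ 2 + 1.
have n2 : 0 < n ^ 2 by rewrite expn_gt0 n_gt0.
have hq : 100 * g <= q * n ^ 2.
  by rewrite /q addn1; apply/ltnW/ltn_ceil.
have [T TG [Tq KE [u hu hF']]] := @approx_hitting A K q I AX K0 n12 hq.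
rewrite -/g -/C -/t in hu hF'.
have ut : u <= t.
  have : 2 ^ I * u <= 2 ^ I * t.
    by apply: leq_trans hu (leq_trans hg _); rewrite leq_mul2r hI orbT.
  by rewrite leq_pmul2l // expn_gt0.
set E := ushadow T :\: C in KE.
have UE : ushadow T :&: C = ushadow T :\: E.
  by apply/setP => x; rewrite !in_setD !in_setI; do !case: (_ \in _).
rewrite UE in hF'.
have CX : C \subset X := cl_sub A.
have sC : shadow C = shadow A by apply: shadow_cl.
have UEC : ushadow T :\: E \subset C by rewrite -UE subsetIr.
set F' := shadow (ushadow T :\: E) in hF'.
have F'G : F' \subset shadow A by rewrite -sC; apply: shadowS.
have hF2 : #|shadow A :\: F'| <= 28 * K * t.
  apply: leq_trans hF' _; rewrite (_ : 28 * K * t = 27 * K * t + K * t); last by ring.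
  by rewrite leq_add2l (leq_trans ut) // leq_pmull.
have [T2 [T3 [[T2C T2p T3p T3S] [CS1 F2G hS1]]]] := @approx_psi A F' p _ AX p0 pn F'G hF2.
set F := F' :|: shadow T2 in T3S CS1 F2G hS1.
set S0 := [set x in X | _] in T3S CS1 F2G hS1.
set S1 := S0 :\: _ in CS1 F2G hS1.
set F2 := F :|: _ in F2G hS1.
pose R := shadow A :\: F2.
have csE a4 : cert_shadow (mk5 [:: T; E; T2; T3; a4]) = F.
  by rewrite /cert_shadow !mk5E //= shadowU.
have psE a4 : psi_container p (mk5 [:: T; E; T2; T3; a4]) = S1.
  by rewrite /psi_container csE mk5E.
have rF y : y \in F -> exists j, exists2 z, z \in mk5 [:: T; E; T2; T3; set0] j & reach 2 y z.
  rewrite in_setU => /orP[/shadowP[x]|/shadowP[x xT yx]].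
    move=> /setDP[/ushadowP[w wT wx] _] yx; exists (inord 0), w; first by rewrite mk5E.
    exact: reach_trans (reach_dn1 yx) (reach_dn wx).
  exists (inord 2), x; first by rewrite mk5E.
  by apply: (@reach_leq _ _ 1) => //; apply: reach_dn1.
have nearE (a4 : {set V}) : a4 \subset shadow A -> close_to (mk5 [:: T; E; T2; T3; a4]) A.
  move=> a4G; split.
    have rC x : x \in C -> exists2 a, a \in A & reach 3 x a.
      by move=> /reach_cl[a aA xa]; exists a => //; apply: reach_leq xa.
    have rG y : y \in shadow A -> exists2 a, a \in A & reach 1 y a by apply: reach_shadow.
    have rG3 y : y \in shadow A -> exists2 a, a \in A & reach 3 y a.
      by move=> /rG[a aA ya]; exists a => //; apply: reach_leq ya.
    apply: mk5P => z.
    - by move=> /(subsetP TG)/rG3.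
    - move=> /setDP[/ushadowP[y /(subsetP TG)/rG[a aA ya] yz] _].
      exists a => //; apply: (@reach_leq _ _ 2) => //; exact: reach_trans (reach_dn yz) ya.
    - by move=> /(subsetP T2C)/rC.
    - move=> /T3S[x]; rewrite inE => /andP[xX xp] zx.
      have [y /setIP[yx yF]] : exists y, y \in dn x :&: F.
        exact: dn_meets pn2 xp.
      have yG : y \in shadow A by apply: (subsetP F2G); rewrite in_setU yF.
      have [a aA ya] := rG _ yG; exists a => //.
      exact: reach_trans (reach_trans (reach_dn1 zx) (reach_dn yx)) ya.
    - by move=> /(subsetP a4G)/rG3.
  move=> a aA; have aC : a \in C := subsetP (sub_cl AX) _ aA.
  have := subsetP CS1 _ aC; rewrite in_setD inE => /andP[_ /andP[aX ap]].
  have [y /setIP[ya /rF[j [z zj yz]]]] : exists y, y \in dn a :&: F.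
    exact: dn_meets pn2 ap.
  exists j, z; last exact: reach_trans (reach_dn ya) yz.
  move: j zj {yz} => [[|[|[|[|[|//]]]]] ?]; rewrite /mk5 //= inE //.
have tg : #|C| + t = g by rewrite subnKC // card_cl_le.
have fr : #|F2| + #|R| = g by rewrite /g -(cardsID F2 (shadow A)) (setIidPr F2G).
have n2t : n <= t.
  apply: leq_trans ht; apply: (@leq_trans (n ^ 2)); first by rewrite -mulnn leq_pmulr.
  by rewrite leq_pmull // muln_gt0.
have arith1 := @certificate_arith n b t g I K p q _ _ _ _ n_gt0 b0 I0 hK hp Kn n2t hg erefl Tq KE T2p T3p.
have [arA arB] := @container_arith n b t g K p _ _ _ _ _ n_gt0 b0 hn ht arith1 fr tg hS1 K0.
have [big|small] := leqP t (4 * b * #|R|).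
  exists (inord 1), (mk5 [:: T; E; T2; T3; set0]); split.
  - by apply: nearE; rewrite sub0set.
  - by rewrite /container inordK // psE (subset_trans _ CS1) // sub_cl.
  by rewrite /container inordK // psE sum_mk5 cards0 addn0; apply: arA.
exists (inord 2), (mk5 [:: T; E; T2; T3; R]).
have cE : container p (inord 2) (mk5 [:: T; E; T2; T3; R]) = C.
  rewrite /container inordK // csE psE mk5E //=.
  apply/setP => x; rewrite [x \in C]inE inE; congr (_ && (_ \subset _)).
  by rewrite -/F2 /R -{1}(setIidPr F2G) setID.
split.
- by apply: nearE; apply: subsetDl.
- by rewrite cE sub_cl.
by rewrite cE sum_mk5; apply: arB.
Qed.

End Middle.
End Container.

(** * The grid *)

(** Use 4ab <= (a+b)^2 [a] times, and b <= a+b for the other b-a factors. This is the induction step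
    for merging two parts joined by at most min(a, b) edges. *)
Lemma mul_pow4_le (a b : nat) : a <= b -> 4 ^ a * (a ^ a * b ^ b) <= (a + b) ^ (a + b).
Proof.
move=> ab; have -> : b ^ b = b ^ a * b ^ (b - a) by rewrite -expnD subnKC.
have -> : (a + b) ^ (a + b) = ((a + b) ^ 2) ^ a * (a + b) ^ (b - a).
  by rewrite -expnM -expnD; congr (_ ^ _); lia.
rewrite !mulnA -!expnMn leq_mul //.
  by case: a ab => // a ab; rewrite leq_exp2r // -mulnn; nia.
by case: (b - a) => // k; rewrite leq_exp2r // leq_addl.
Qed.

Section Grid.
Variable n : nat.
Local Notation V := (grid n).
Implicit Types (x y z : V) (i j : 'I_n) (S A : {set V}).

Definition digit x i : nat := tnth x i.
Definition rank x := \sum_(i < n) digit x i.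
Definition of_digit (f : 'I_n -> nat) : V := [tuple (inord (f i) : 'I_3) | i < n].

Lemma digit_lt3 x i : digit x i < 3. Proof. exact: ltn_ord. Qed.

Lemma digit_of f i : f i < 3 -> digit (of_digit f) i = f i.
Proof. by move=> f3; rewrite /digit tnth_mktuple inordK. Qed.

Lemma digit_inj x y : digit x =1 digit y -> x = y.
Proof. by move=> h; apply: eq_from_tnth => i; apply/val_inj/h. Qed.

Lemma leP_digit x y : reflect (forall i, digit x i <= digit y i) (x <= y)%O.
Proof. by rewrite leEtprod; apply: (iffP forallP). Qed.

Lemma rank_le x y : (x <= y)%O -> rank x <= rank y.
Proof. by move=> /leP_digit h; apply: leq_sum => i _. Qed.

Lemma eq_rank x y : (x <= y)%O -> rank y <= rank x -> x = y.
Proof.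
move=> /leP_digit h hr; apply: digit_inj.
have := leqif_sum (P := xpredT) (fun i _ => leqif_eq (h i)).
case=> le; rewrite -/(rank x) -/(rank y) in le *.
rewrite eqn_leq le hr => /esym/forall_inP e i; exact/eqP/e.
Qed.

(** Truncated subtraction and [minn] make [lower] and [raise] the identity where the move is
    impossible; hence the digit conditions below. *)
Definition lower i x := of_digit (fun j => digit x j - (j == i)).
Definition raise i x := of_digit (fun j => minn 2 (digit x j + (j == i))).

Lemma digit_lower i x j : digit (lower i x) j = digit x j - (j == i).
Proof. by rewrite digit_of // (leq_ltn_trans (leq_subr _ _)) ?digit_lt3. Qed.

Lemma digit_raise i x j : digit x i < 2 -> digit (raise i x) j = digit x j + (j == i).
Proof.
move=> x2; have h : digit x j + (j == i) <= 2.
  by case: eqP => [->|_]; rewrite ?addn1 ?addn0 // -ltnS digit_lt3.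
by rewrite digit_of /=; rewrite (minn_idPr h).
Qed.

Lemma lowerK i x : 0 < digit x i -> raise i (lower i x) = x.
Proof.
move=> x0; apply: digit_inj => j; rewrite digit_raise.
  by rewrite digit_lower; case: eqP => [->|]; lia.
by rewrite digit_lower eqxx; have := digit_lt3 x i; lia.
Qed.

Lemma raiseK i x : digit x i < 2 -> lower i (raise i x) = x.
Proof.
by move=> x2; apply: digit_inj => j; rewrite digit_lower digit_raise // addnK.
Qed.

Lemma digit_raise_gt0 i x : digit x i < 2 -> 0 < digit (raise i x) i.
Proof. by move=> x2; rewrite digit_raise // eqxx addn1. Qed.

Lemma lower_le i x : (lower i x <= x)%O.
Proof. by apply/leP_digit => j; rewrite digit_lower leq_subr. Qed.

Lemma rank_lower i x : 0 < digit x i -> rank x = (rank (lower i x)).+1.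
Proof.
move=> x0; rewrite /rank (bigD1 i) //= [in RHS](bigD1 i) //= digit_lower eqxx.
rewrite -addSn subn1 prednK //; congr (_ + _); apply: eq_bigr => j /negbTE ji.
by rewrite digit_lower ji subn0.
Qed.

Lemma lower_inj i j x : 0 < digit x i -> lower i x = lower j x -> i = j.
Proof.
move=> x0 /(congr1 (fun y => digit y i)); rewrite !digit_lower eqxx.
by case: eqP => //; lia.
Qed.

Lemma raise_inj i j x : digit x i < 2 -> digit x j < 2 -> raise i x = raise j x -> i = j.
Proof.
move=> xi xj /(congr1 (fun y => digit y i)); rewrite !digit_raise // eqxx.
by case: eqP => //; lia.
Qed.

Definition cov x y := (y <= x)%O && (rank x == (rank y).+1).

Local Notation dn := (dn cov).
Local Notation up := (up cov).
Local Notation shadow := (shadow cov).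

Lemma lt_lower y x : (y <= x)%O -> rank y < rank x ->
  exists2 i, 0 < digit x i & (y <= lower i x)%O.
Proof.
move=> /leP_digit yx lt.
have [i lti] : exists i, digit y i < digit x i.
  apply/existsP; apply: contraT; rewrite negb_exists => /forallP h.
  suff : rank x <= rank y by rewrite leqNgt lt.
  by apply: leq_sum => i _; rewrite leqNgt h.
exists i; first exact: leq_ltn_trans lti.
by apply/leP_digit => j; rewrite digit_lower; case: eqP => [->|_]; rewrite ?subn0 //; lia.
Qed.

Lemma dnP x y : reflect (exists2 i, 0 < digit x i & y = lower i x) (y \in dn x).
Proof.
rewrite inE; apply: (iffP andP) => [[yx /eqP hr]|[i x0 ->]]; last first.
  by rewrite lower_le (rank_lower x0) eqxx.
have [|i x0 yl] := lt_lower yx; first by rewrite hr.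
exists i => //; apply: eq_rank yl _.
by move: hr; rewrite (rank_lower x0) => -[->].
Qed.

Lemma upP x y : reflect (exists2 i, digit y i < 2 & x = raise i y) (x \in up y).
Proof.
rewrite mem_up; apply: (iffP (dnP _ _)) => -[i h ->]; exists i.
- by rewrite digit_lower eqxx; have := digit_lt3 x i; lia.
- by rewrite lowerK.
- exact: digit_raise_gt0.
- by rewrite raiseK.
Qed.

Lemma dnE x : dn x = lower^~ x @: [set i | 0 < digit x i].
Proof.
apply/setP => y; apply/dnP/imsetP => -[i].
  by move=> x0 ->; exists i; rewrite ?inE.
by rewrite inE => x0 ->; exists i.
Qed.

Lemma upE y : up y = raise^~ y @: [set i | digit y i < 2].
Proof.
apply/setP => x; apply/upP/imsetP => -[i].
  by move=> x0 ->; exists i; rewrite ?inE.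
by rewrite inE => x0 ->; exists i.
Qed.

Lemma sum_dn (R : nmodType) (F : V -> R) x :
  (\sum_(y in dn x) F y = \sum_(i | (0 < digit x i)%N) F (lower i x))%R.
Proof.
rewrite dnE big_imset /=; last by move=> i j; rewrite inE => x0 _; apply: lower_inj.
by apply: eq_bigl => i; rewrite inE.
Qed.

Lemma sum_up (R : nmodType) (F : V -> R) y :
  (\sum_(x in up y) F x = \sum_(i | (digit y i < 2)%N) F (raise i y))%R.
Proof.
rewrite upE big_imset /=; last by move=> i j; rewrite !inE; apply: raise_inj.
by apply: eq_bigl => i; rewrite inE.
Qed.

Definition nb k x := #|[set i | digit x i == k]|.

Lemma card_dn x : #|dn x| = nb 1 x + nb 2 x.
Proof.
rewrite dnE card_in_imset; last by move=> i j; rewrite inE => x0 _; apply: lower_inj.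
rewrite -cardsUI (_ : _ :&: _ = set0) ?cards0 ?addn0; last first.
  by apply/setP => i; rewrite !inE; case: eqP => // ->.
congr #|pred_of_set _|; apply/setP => i; rewrite !inE.
by have := digit_lt3 x i; case: (digit x i) => [|[|[|]]].
Qed.

Lemma card_up x : #|up x| = nb 0 x + nb 1 x.
Proof.
rewrite upE card_in_imset; last by move=> i j; rewrite !inE; apply: raise_inj.
rewrite -cardsUI (_ : _ :&: _ = set0) ?cards0 ?addn0; last first.
  by apply/setP => i; rewrite !inE; case: eqP => // ->.
congr #|pred_of_set _|; apply/setP => i; rewrite !inE.
by have := digit_lt3 x i; case: (digit x i) => [|[|[|]]].
Qed.

Lemma nb_sum x : nb 0 x + nb 1 x + nb 2 x = n.
Proof.
rewrite -[RHS]card_ord -sum1_card /nb -!sum1_card.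
rewrite (big_mkcond (fun i => i \in [set i | digit x i == 0])).
rewrite (big_mkcond (fun i => i \in [set i | digit x i == 1])).
rewrite (big_mkcond (fun i => i \in [set i | digit x i == 2])) -!big_split /=.
apply: eq_bigr => i _; rewrite !inE.
by have := digit_lt3 x i; case: (digit x i) => [|[|[|]]].
Qed.

Lemma rank_nb x : rank x = nb 1 x + 2 * nb 2 x.
Proof.
rewrite /rank /nb -!sum1_card big_distrr /=.
rewrite (big_mkcond (fun i => i \in [set i | digit x i == 1])).
rewrite (big_mkcond (fun i => i \in [set i | digit x i == 2])) -!big_split /=.
apply: eq_bigr => i _; rewrite !inE.
by have := digit_lt3 x i; case: (digit x i) => [|[|[|]]].
Qed.

(** A coordinate 2 counts only for the down-degree, a coordinate 0 only for the up-degree. The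
    surplus of the down-degree is thus the height above L_n, the source of expansion. *)
Lemma card_dn_up x : #|dn x| + n = #|up x| + rank x.
Proof. by rewrite card_dn card_up rank_nb -{1}(nb_sum x); lia. Qed.

Lemma card_dn_le x : #|dn x| <= n.
Proof. by rewrite card_dn -[leqRHS](nb_sum x); lia. Qed.

Lemma rank_le_dn x : rank x <= 2 * #|dn x|.
Proof. by rewrite card_dn rank_nb; lia. Qed.

Lemma nb_lower i k x : 0 < digit x i ->
  nb k (lower i x) + (k == digit x i) = nb k x + (k == (digit x i).-1).
Proof.
move=> x0; rewrite /nb.
rewrite [#|[set j | digit (lower i x) j == k]|](cardsD1 i).
rewrite [#|[set j | digit x j == k]|](cardsD1 i) !inE digit_lower eqxx subn1.
have -> : [set j | digit (lower i x) j == k] :\ i = [set j | digit x j == k] :\ i.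
  apply/setP => j; rewrite !inE digit_lower; case: eqP => //= _.
  by rewrite subn0.
by rewrite ![_ == k]eq_sym; lia.
Qed.

(** Lowering 2 to 1 frees one coordinate for raising; lowering 1 to 0 frees none. *)
Lemma card_up_lower x y : y \in dn x -> #|up y| <= #|up x|.+1.
Proof.
case/dnP => i x0 ->; rewrite !card_up.
have := nb_lower 0 x0; have := nb_lower 1 x0.
by have := digit_lt3 x i; case: (digit x i) x0 => [|[|[|]]] //=; lia.
Qed.

Lemma rank_dn x y : y \in dn x -> rank x = (rank y).+1.
Proof. by rewrite inE => /andP[_ /eqP]. Qed.

Lemma le_dn x y : y \in dn x -> (y <= x)%O.
Proof. by rewrite inE => /andP[]. Qed.

Lemma mem_dn_le x y : (y <= x)%O -> rank x = (rank y).+1 -> y \in dn x.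
Proof. by move=> yx hr; rewrite inE /cov yx hr eqxx. Qed.

Lemma card_adj x : #|[set w | adj cov x w]| <= 2 * n + 1.
Proof.
have -> : [set w | adj cov x w] = [set x] :|: dn x :|: up x.
  by apply/setP => w; rewrite !inE /adj eq_sym orbA.
apply: leq_trans (leq_card_setU _ _) _.
have h : #|[set x] :|: dn x| <= 1 + #|dn x|.
  by rewrite (leq_trans (leq_card_setU _ _)) // cards1.
have : #|up x| <= n by rewrite card_up -[leqRHS](nb_sum x); lia.
by have := card_dn_le x; lia.
Qed.

Definition meet x y := of_digit (fun i => minn (digit x i) (digit y i)).

Lemma digit_meet x y i : digit (meet x y) i = minn (digit x i) (digit y i).
Proof. by rewrite digit_of // (leq_ltn_trans (geq_minl _ _)) ?digit_lt3. Qed.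

(** A common lower neighbour must be the meet. *)
Lemma codegree x x' : rank x = rank x' -> x != x' -> #|dn x :&: dn x'| <= 1.
Proof.
move=> hr xx'; apply/card_le1P => y; rewrite inE => /andP[yx yx'] z.
suff main w : w \in dn x -> w \in dn x' -> w = meet x x'.
  rewrite (main _ yx yx') inE; apply/andP/eqP => [[zx zx']|->]; first exact: main.
  by rewrite -(main _ yx yx').
move=> wx wx'; apply: eq_rank.
  apply/leP_digit => i; rewrite digit_meet leq_min.
  by rewrite (leP_digit _ _ (le_dn wx)) (leP_digit _ _ (le_dn wx')).
rewrite -ltnS -(rank_dn wx) ltn_neqAle.
have mx : (meet x x' <= x)%O by apply/leP_digit => i; rewrite digit_meet geq_minl.
rewrite rank_le // andbT; apply: contraNneq xx' => e.
have mE := eq_rank mx (eq_leq (esym e)).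
apply/eqP; apply: eq_rank; last by rewrite hr.
by rewrite -mE; apply/leP_digit => i; rewrite digit_meet geq_minr.
Qed.

(** [v] has at least n/2 lower neighbours, and so has each of these. An element two steps below [v]
    is reached through at most two of them, one for each order of lowering its two coordinates. *)
Lemma card_shadow2 v : 0 < n -> n < rank v -> n ^ 2 <= 8 * #|shadow (dn v)|.
Proof.
move=> n0 nv.
have h1 : n * #|dn v| <= 2 * \sum_(x in dn v) #|dn x :&: shadow (dn v)|.
  rewrite mulnC -sum_nat_const big_distrr /=; apply: leq_sum => x xv.
  rewrite (setIidPl (dn_sub_shadow cov xv)) (leq_trans _ (rank_le_dn x)) //.
  by rewrite -ltnS -(rank_dn xv).
have h2 : \sum_(y in shadow (dn v)) #|up y :&: dn v| <= 2 * #|shadow (dn v)|.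
  rewrite mulnC -sum_nat_const; apply: leq_sum => y /shadowP[x /dnP[i v0 ->]].
  move=> /dnP[j _ ->]; apply: (@leq_trans #|[set lower i v; lower j v]|); last first.
    by rewrite cards2; case: (_ != _).
  apply: subset_leq_card; apply/subsetP => w; rewrite in_setI mem_up => /andP[wy].
  move=> /dnP[l vl we]; rewrite we in_set2.
  have := leP_digit _ _ (le_dn wy) l; rewrite we !digit_lower eqxx.
  case: (eqVneq l i) => [->|_]; first by rewrite eqxx.
  case: (eqVneq l j) => [->|_]; first by rewrite eqxx orbT.
  by lia.
move: h1; rewrite double_count => h1.
by have := rank_le_dn v; rewrite -mulnn; nia.
Qed.

(* Split S by the value of a coordinate that is not constant on S: the edges between
   the two parts form a matching. *)
Lemma edge_isoperimetry S : 4 ^ (\sum_(x in S) #|dn x :&: S|) <= #|S| ^ #|S|.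
Proof.
have [m] := ubnP #|S|; elim: m S => // m IH S; rewrite ltnS => Sm.
have [S1|] := leqP #|S| 1.
  rewrite (_ : \sum_(_ in _) _ = 0).
    by move: S1; case: #|S| => [|[|]].
  apply: big1 => x xS; apply/eqP; rewrite cards_eq0 -subset0; apply/subsetP => y.
  rewrite in_setI => /andP[yx yS].
  have := card_le1_eqP S1 x y xS yS => xy.
  by have := rank_dn yx; rewrite xy => /eqP; rewrite eqn_leq ltnn andbF.
case/card_gt1P => x [y [xS yS xy]].
have [u [w [uS wS [i uw]]]] : exists u w, [/\ u \in S, w \in S & exists i, digit u i < digit w i].
  have [i xyi] : exists i, digit x i != digit y i.
    apply/existsP; apply: contraNT xy; rewrite negb_exists => /forallP h.
    by apply/eqP/digit_inj => i; apply/eqP; move: (h i); rewrite negbK.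
  case: (ltngtP (digit x i) (digit y i)) xyi => // h _.
    by exists x, y; split => //; exists i.
  by exists y, x; split => //; exists i.
pose S1 := [set z in S | digit z i <= digit u i].
pose S2 := S :\: S1.
have S1S : S1 \subset S by apply/subsetP => z; rewrite inE => /andP[].
have c12 : #|S1| + #|S2| = #|S| by rewrite -(cardsID S1 S) (setIidPr S1S).
have c1 : 0 < #|S1| by apply/card_gt0P; exists u; rewrite inE uS leqnn.
have c2 : 0 < #|S2|.
  by apply/card_gt0P; exists w; rewrite in_setD inE wS /= -ltnNge uw.
have cross z z' : z \in S2 -> z' \in S1 -> z' \in dn z -> z' = lower i z.
  rewrite !inE => /andP[+ zS] /andP[z'S le] /andP[z'z hr]; rewrite zS -ltnNge /= => lt.
  have /dnP[j z0 e] : z' \in dn z by rewrite inE /cov z'z hr.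
  move: le; rewrite e digit_lower; case: (eqVneq i j) => [->//|_].
  by rewrite subn0 leqNgt lt.
have split_sum : \sum_(z in S) #|dn z :&: S| =
    \sum_(z in S1) #|dn z :&: S1| + \sum_(z in S2) #|dn z :&: S2| +
    \sum_(z in S2) #|dn z :&: S1|.
  rewrite (big_setID S1) /= (setIidPr S1S) -addnA -big_split /=; congr (_ + _).
    apply: eq_bigr => z; rewrite inE => /andP[zS zu]; congr #|pred_of_set _|.
    apply/setP => z'; rewrite !in_setI; case: (boolP (z' \in dn z)) => //= z'z.
    rewrite [z' \in S1]inE (leq_trans _ zu) ?andbT //; exact: leP_digit (le_dn z'z) i.
  apply: eq_bigr => z _; rewrite addnC -(cardsID S1) -setIA (setIidPr S1S).
  by rewrite setIDA.
have cr1 : \sum_(z in S2) #|dn z :&: S1| <= #|S2|.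
  rewrite -sum1_card; apply: leq_sum => z z2; rewrite leqNgt.
  apply/negP => /card_gt1P[a [b [/setIP[az a1] /setIP[bz b1]]]].
  by rewrite (cross _ _ z2 a1 az) (cross _ _ z2 b1 bz) eqxx.
have cr2 : \sum_(z in S2) #|dn z :&: S1| <= #|S1|.
  rewrite double_count -sum1_card; apply: leq_sum => z z1; rewrite leqNgt.
  apply/negP => /card_gt1P[a [b [/setIP[]]]].
  rewrite !mem_up => za a2 /setIP[]; rewrite mem_up => zb b2.
  have lz c : c \in S2 -> z \in dn c -> c = raise i z.
    move=> c2' zc; rewrite {1}(cross _ _ c2' z1 zc) lowerK //.
    move: c2'; rewrite !inE => /andP[+ cS]; rewrite cS -ltnNge.
    exact: leq_ltn_trans.
  by rewrite (lz _ a2 za) (lz _ b2 zb) eqxx.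
rewrite split_sum !expnD -c12.
have i1 := IH S1 _; have i2 := IH S2 _.
have {}i1 := i1 ltac:(lia); have {}i2 := i2 ltac:(lia).
set e := \sum_(_ in S2) #|dn _ :&: S1| in cr1 cr2 *.
have fin : 4 ^ e * (#|S1| ^ #|S1| * #|S2| ^ #|S2|) <= (#|S1| + #|S2|) ^ (#|S1| + #|S2|).
  have [le|/ltnW le] := leqP #|S1| #|S2|.
    apply: leq_trans (mul_pow4_le le); by rewrite leq_mul2r leq_exp2l // cr2 orbT.
  rewrite [#|S1| ^ _ * _]mulnC addnC; apply: leq_trans (mul_pow4_le le).
  by rewrite leq_mul2r leq_exp2l // cr1 orbT.
rewrite mulnC; apply: leq_trans fin.
by rewrite leq_mul2l leq_mul ?orbT.
Qed.

(** The union of [A] and its shadow spans at least n|A|/2 edges, while [edge_isoperimetry] allows s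
    elements only (s log s)/2 edges, with logarithm to base 2. *)
Lemma small_set_expansion A l : (forall x, x \in A -> n <= rank x) ->
  #|A| + #|shadow A| <= 2 ^ l -> n * #|A| <= l * (#|A| + #|shadow A|).
Proof.
move=> hA hl; pose S := A :|: shadow A.
have cS : #|S| <= #|A| + #|shadow A| by apply: leq_card_setU.
have [S0|S0] := posnP #|S|.
  have : #|A| <= #|S| by rewrite subset_leq_card // subsetUl.
  by rewrite S0 leqn0 => /eqP ->; rewrite muln0.
have h1 : n * #|A| <= 2 * \sum_(x in S) #|dn x :&: S|.
  rewrite (big_setID A) /= mulnDr (leq_trans _ (leq_addr _ _)) //.
  rewrite /S setUK mulnC -sum_nat_const big_distrr /=; apply: leq_sum => x xA.
  rewrite (setIidPl _); first by rewrite (leq_trans (hA _ xA)) // rank_le_dn.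
  exact: subset_trans (dn_sub_shadow cov xA) (subsetUr _ _).
have h2 : 2 ^ (2 * \sum_(x in S) #|dn x :&: S|) <= 2 ^ (l * #|S|).
  rewrite expnM (leq_trans (edge_isoperimetry S)) // expnM leq_exp2r //.
  exact: leq_trans cS hl.
rewrite leq_exp2l // in h2; apply: leq_trans h1 (leq_trans h2 _).
by rewrite leq_mul2l cS orbT.
Qed.

End Grid.

(** * Expansion of shadows in the grid *)

(** All parameters are polynomial in L, which is about log n. This class shows that they stay below
    n eventually, without tracking degrees. *)
Definition polynomial_growth (f : nat -> nat) :=
  exists C d, forall k, 0 < k -> f k <= C * k ^ d.

Lemma polynomial_cst c : polynomial_growth (fun=> c).
Proof. by exists c, 0 => k _; rewrite muln1. Qed.

Lemma polynomial_id : polynomial_growth id.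
Proof. by exists 1, 1 => k _; rewrite mul1n. Qed.

Lemma polynomialM f g : polynomial_growth f -> polynomial_growth g ->
  polynomial_growth (fun k => f k * g k).
Proof.
move=> [C [d hf]] [C' [d' hg]]; exists (C * C'), (d + d') => k k0.
by rewrite expnD mulnACA leq_mul ?hf ?hg.
Qed.

Lemma polynomialD f g : polynomial_growth f -> polynomial_growth g ->
  polynomial_growth (fun k => f k + g k).
Proof.
move=> [C [d hf]] [C' [d' hg]]; exists (C + C'), (d + d') => k k0.
rewrite mulnDl leq_add //.
  by rewrite (leq_trans (hf _ k0)) // leq_mul2l leq_pexp2l ?orbT // leq_addr.
by rewrite (leq_trans (hg _ k0)) // leq_mul2l leq_pexp2l ?orbT // leq_addl.
Qed.

Lemma polynomial_le_exp f c : polynomial_growth f ->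
  exists k0, forall k, k0 <= k -> f k * 2 ^ c <= 2 ^ k.
Proof.
move=> [C [d hf]].
have lt2 m : m < 2 ^ m by apply: ltn_expl.
exists ((C * d.+1 ^ d * 2 ^ c).+1 * d.+1) => k hk.
have k0 : 0 < k by apply: leq_trans hk; rewrite muln_gt0.
pose q := k %/ d.+1.
have kq : k <= d.+1 * q.+1 by rewrite mulnC ltnW // ltn_ceil.
have qk : q * d.+1 <= k by apply: leq_trunc_div.
have Cq : C * d.+1 ^ d * 2 ^ c <= q.
  by rewrite ltnW // leq_divRL.
apply: leq_trans (_ : C * (d.+1 * q.+1) ^ d * 2 ^ c <= _).
  rewrite leq_mul2r (leq_trans (hf _ k0)) ?orbT // leq_mul2l; apply/orP; right.
  by case: d {hf hk qk Cq} @q kq => // d q kq; rewrite leq_exp2r.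
apply: leq_trans (_ : 2 ^ (q * d.+1) <= _); last by rewrite leq_pexp2l.
rewrite expnMn mulnS expnD expnM.
apply: leq_trans (_ : q * (2 ^ q) ^ d <= _); last by rewrite leq_mul2r ltnW ?orbT.
apply: leq_trans (_ : C * d.+1 ^ d * 2 ^ c * q.+1 ^ d <= _).
  by rewrite leq_eqVlt; apply/orP; left; apply/eqP; ring.
rewrite leq_mul //.
by case: (d) => // d'; rewrite leq_exp2r // lt2.
Qed.

(* n < 2^L, and a certificate element costs cert_cost L bits: a detour of length 24 in a
   graph of degree at most 2n+1, and 10 labels per visited vertex. *)
Definition cert_cost (L : nat) := 300 * L.
(** [good_loss] and [mid_psi] are the [K] and [p] of [certificate_arith]. The number of halvings is
    L + 6, as 2^(L+6) >= 64(2n+1) >= 65n. *)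
Definition good_loss L := 100 * 100 * 100 * cert_cost L ^ 2 * (L + 6).
Definition mid_psi L := 1120 * good_loss L * cert_cost L ^ 2.
(** One summand for each lower bound on n: the middle layers, the slack of large sets, the listing
    of small sets, and an absolute constant. *)
Definition requirement L :=
  52 * 100 * good_loss L * mid_psi L * cert_cost L +
  52 * 100 * cert_cost L + 4 * (cert_cost L + 1) * (4 * L + 1) + 100.

Lemma requirement_growth : polynomial_growth requirement.
Proof.
have cst := polynomial_cst; have id_ := polynomial_id.
have cc : polynomial_growth cert_cost by exact: polynomialM.
have c2 : polynomial_growth (fun L => cert_cost L ^ 2).
  by rewrite /polynomial_growth; exact: (polynomialM cc cc).
have gl : polynomial_growth good_loss.
  by apply: polynomialM; [apply: polynomialM|apply: polynomialD].
have mp : polynomial_growth mid_psi.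
  by apply: polynomialM => //; apply: polynomialM.
apply: polynomialD; last exact: cst.
apply: polynomialD; last first.
  apply: polynomialM; [apply: polynomialM => //; exact: polynomialD|].
  by apply: polynomialD => //; apply: polynomialM.
apply: polynomialD; last exact: polynomialM.
by do 2![apply: polynomialM => //]; apply: polynomialM.
Qed.

Lemma large_requirement : exists n0, forall n, n0 <= n ->
  exists L, [/\ 0 < L, 2 * n + 1 <= 2 ^ L & requirement L <= n].
Proof.
have [k0 hk] := polynomial_le_exp 2 requirement_growth.
(* This L satisfies 2n+1 <= 2^L <= 4n; the spare factor 2^2 turns a bound by 2^L into one by n. *)
exists (2 ^ k0).+1 => n hn; exists (trunc_log 2 n + 2).
have n0 : 0 < n by apply: leq_trans hn.
have h1 : 2 ^ trunc_log 2 n <= n by apply: trunc_logP.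
have h2 : n < 2 ^ (trunc_log 2 n).+1 by apply: trunc_log_ltn.
split; first by rewrite addn2.
  by rewrite addn2 expnS; lia.
have : requirement (trunc_log 2 n + 2) * 2 ^ 2 <= 2 ^ (trunc_log 2 n + 2).
  apply: hk; rewrite (leq_trans (trunc_log_max _ (ltnW hn))) ?leq_addr //.
by rewrite expnD leq_pmul2r // => /leq_trans; apply.
Qed.

(** * Expansion by weighted flows *)

Section RealExpansion.
Local Open Scope ring_scope.

Lemma weighted_expansion (F : realFieldType) (V : finType) (cv : rel V) (w : V -> V -> F)
    (A : {set V}) (c : F) :
  (forall x, x \in A -> c <= \sum_(y in dn cv x) w x y) ->
  (forall y, y \in shadow cv A -> \sum_(x in up cv y) w x y <= 1) ->
  (forall x y, y \in dn cv x -> 0 <= w x y) ->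
  c * #|A|%:R <= #|shadow cv A|%:R.
Proof.
move=> hx hy h0; rewrite mulr_natr -sumr_const.
apply: le_trans (ler_sum _ hx) _; rewrite exchange_shadow.
rewrite -[leRHS]mulr1 mulr_natl -sumr_const; apply: ler_sum => y yA.
apply: le_trans (hy _ yA); rewrite [leRHS](big_setID A) /= lerDl.
by apply: sumr_ge0 => x /setDP[]; rewrite mem_up => /h0.
Qed.

(* The perturbation by s moves mass from the edges 1 -> 0 to the edges 2 -> 1,
   which restores a gain of order 1/N even when there are few coordinates 1. *)
Lemma middle_flow (F : realFieldType) (a b N : F) (s := (4 * N ^+ 2)^-1) :
  0 <= a -> 0 <= b -> 0 < a + b -> N = 2 * a + b + 1 -> 4 <= N ->
  1 + (64 * N)^-1 <=
  (a + 1) * ((1 + a * s) / (a + b + 1)) + b * ((1 - (b - 1) * s) / (a + b)).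
Proof.
move=> a0 b0 ab NE N4.
have N0 : 0 < N by lra.
have s0 : 0 <= s by rewrite /s invr_ge0 mulr_ge0 // exprn_ge0 // ltW.
have sN : 4 * N ^+ 2 * s = 1 by rewrite /s divff // mulf_neq0 ?pnatr_eq0 // expf_neq0 // lt0r_neq0.
set P := a + b in ab *; have PN : P + 1 <= N by rewrite /P; lra.
have P10 : 0 < P + 1 by lra.
have -> : (a + 1) * ((1 + a * s) / (P + 1)) + b * ((1 - (b - 1) * s) / P) =
  1 + (b / P * ((P + 1)^-1 - (b - 1) * s) + s * (a * (a + 1)) / (P + 1)).
  rewrite /P; field; rewrite -/P; lra.
rewrite lerD2l.
have iN : N^-1 <= (P + 1)^-1 by rewrite lef_pV2 ?posrE.
have sNv : s = N^-1 * N^-1 / 4 by rewrite /s; field; lra.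
have h1 : (b - 1) * s <= N^-1 / 4.
  rewrite sNv mulrA ler_pM2r ?invr_gt0 // mulrA -[leRHS]mul1r ler_pM2r ?invr_gt0 //.
  by rewrite ler_pdivrMr //; lra.
have h2 : b / N * (3 / 4 * N^-1) <= b / P * ((P + 1)^-1 - (b - 1) * s).
  apply: ler_pM.
  - by rewrite divr_ge0 // ltW.
  - have : 0 < N^-1 by rewrite invr_gt0.
    lra.
  - by rewrite ler_wpM2l // lef_pV2 ?posrE //; lra.
  - lra.
have h3 : s * (a * (a + 1)) / N <= s * (a * (a + 1)) / (P + 1).
  by apply: ler_wpM2l => //; rewrite mulr_ge0 // mulr_ge0 //; lra.
apply: le_trans (lerD h2 h3).
rewrite sNv.
have -> : b / N * (3 / 4 * N^-1) + N^-1 * N^-1 / 4 * (a * (a + 1)) / N =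
   (48 * b * N + 16 * (a * (a + 1))) / N ^+ 2 * (64 * N)^-1 by field; lra.
rewrite -[leLHS]mul1r ler_wpM2r //; first by rewrite invr_ge0; lra.
rewrite ler_pdivlMr ?exprn_gt0 // mul1r expr2.
(* Either b >= N/4 and the term with b suffices, or a >= N/4 and the term created by the
   perturbation does. *)
have [bN|bN] := leP N (4 * b).
  have : N * N <= 4 * b * N by rewrite ler_pM2r.
  have : 0 <= a * (a + 1) by rewrite mulr_ge0 //; lra.
  have : 0 <= b * N by rewrite mulr_ge0 // ltW.
  lra.
have aN : N <= 4 * a by lra.
have : N * N <= 4 * a * (4 * a) by rewrite ler_pM // ltW.
have : 0 <= b * N by rewrite mulr_ge0 // ltW.
lra.
Qed.

Section GridExpansion.
Variable n : nat.
Hypothesis n4 : (4 <= n)%N.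
Local Notation V := (grid n).
Local Notation dn := (dn (@cov n)).
Local Notation up := (up (@cov n)).
Local Notation shadow := (shadow (@cov n)).
Implicit Types (x y : V) (A : {set V}).

Definition lay (k : nat) : {set V} := [set x | rank x == k].

Lemma lay_rank k x : (x \in lay k) = (rank x == k). Proof. by rewrite inE. Qed.

(** On L_{n+1}, lowering a 2 gives [y] with |up y| = |dn x|. Uniform weights 1/|up y| therefore gain
    nothing at an [x] without coordinates 1. *)
Lemma expansion_middle (F : realFieldType) A : A \subset lay n.+1 ->
  (1 + (64 * n%:R)^-1) * #|A|%:R <= #|shadow A|%:R :> F.
Proof.
move=> /subsetP AX.
pose s : F := (4 * n%:R ^+ 2)^-1.
pose ze y : F := (nb 0 y)%:R; pose on y : F := (nb 1 y)%:R.
(* Equal numbers of zeros characterize the edges 2 -> 1. The load of [y] is unchanged by the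
   perturbation: [on y] edges gain in proportion to [ze y], and [ze y] edges lose in proportion to
   [on y]. *)
pose w x y : F := if nb 0 x == nb 0 y then (1 + ze y * s) / (ze y + on y)
  else (1 - on y * s) / (ze y + on y).
have n0 : 0 < n%:R :> F by rewrite ltr0n; lia.
have s0 : 0 <= s by rewrite /s invr_ge0 mulr_ge0 // exprn_ge0 // ltW.
apply: (@weighted_expansion _ _ _ w) => [x /AX|y _|x y _].
- rewrite lay_rank => /eqP hr; rewrite sum_dn.
  have rE := rank_nb x; have nE := nb_sum x.
  rewrite (bigID (fun i : 'I_n => digit x i == 2)) /=.
  rewrite (eq_bigr (fun=> (1 + ze x * s) / (ze x + on x + 1))); last first.
    move=> i /andP[x0 /eqP x2]; have := nb_lower 0 x0; have := nb_lower 1 x0.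
    rewrite /w /ze /on x2 /= !addn0 !addn1 => -> ->; rewrite eqxx.
    by rewrite -[X in _ / (_ + X)]natr1 addrA.
  rewrite [X in _ <= _ + X](eq_bigr (fun=> (1 - (on x - 1) * s) / (ze x + on x))); last first.
    move=> i /andP[x0 x2]; have x1 : digit x i = 1%N.
      by have := digit_lt3 x i; case: (digit x i) x0 x2 => [|[|[|]]].
    have := nb_lower 0 x0; have := nb_lower 1 x0.
    rewrite /w /ze /on x1 /= !addn0 !addn1 => e1 ->; rewrite -e1.
    rewrite eqn_leq ltnn andbF -!natr1 addrK.
    by congr (_ / _); ring.
  rewrite !sumr_const.
  have -> : #|[pred i | (0 < digit x i)%N & digit x i == 2]| = nb 2 x.
    apply: eq_card => i; rewrite !inE; have := digit_lt3 x i.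
    by case: (digit x i) => [|[|[|]]].
  have -> : #|[pred i | (0 < digit x i)%N & digit x i != 2]| = nb 1 x.
    apply: eq_card => i; rewrite !inE; have := digit_lt3 x i.
    by case: (digit x i) => [|[|[|]]].
  have n2E : nb 2 x = (nb 0 x).+1.
    clear -hr rE nE; move: hr rE nE; move: (nb 0 x) (nb 1 x) (nb 2 x) (rank x).
    by move=> z o t r; lia.
  have n2z : n = (2 * nb 0 x + nb 1 x + 1)%N by lia.
  have zo : (0 < nb 0 x + nb 1 x)%N by lia.
  rewrite n2E -[X in _ <= X + _]mulr_natl -[X in _ <= _ + X]mulr_natl -[(nb 0 x).+1%:R]natr1.
  apply: middle_flow => //; rewrite /ze /on.
  + by rewrite -natrD ltr0n.
  + by rewrite {1}n2z natrD natrD natrM.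
  + by rewrite ler_nat.
- rewrite sum_up (bigID (fun i : 'I_n => digit y i == 1)) /=.
  have nbr i : (digit y i < 2)%N -> nb 0 y = (nb 0 (raise i y) + (0 == digit y i))%N.
    move=> y2; have := nb_lower 0 (digit_raise_gt0 y2).
    by rewrite raiseK // digit_raise // eqxx addn1 /= addn0.
  rewrite (eq_bigr (fun=> (1 + ze y * s) / (ze y + on y))); last first.
    by move=> i /andP[/nbr + /eqP y1]; rewrite y1 addn0 /w => <-; rewrite eqxx.
  rewrite [X in _ + X](eq_bigr (fun=> (1 - on y * s) / (ze y + on y))); last first.
    move=> i /andP[y2 y1]; have y0 : digit y i = 0%N by case: (digit y i) y2 y1 => [|[|]].
    have := nbr _ y2; rewrite y0 /= addn1 /w => ->.
    by rewrite eqn_leq ltnn andbF.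
  rewrite !sumr_const.
  have -> : #|[pred i | (digit y i < 2)%N & digit y i == 1]| = nb 1 y.
    by apply: eq_card => i; rewrite !inE; case: (digit y i) => [|[|]].
  have -> : #|[pred i | (digit y i < 2)%N & digit y i != 1]| = nb 0 y.
    by apply: eq_card => i; rewrite !inE; case: (digit y i) => [|[|]].
  rewrite -[X in X + _]mulr_natl -[X in _ + X]mulr_natl -/(on y) -/(ze y).
  have [e|ne] := eqVneq (ze y + on y) 0.
    by rewrite e invr0 !mulr0 addr0.
  by rewrite !mulrA -mulrDl ler_pdivrMr ?mul1r; [|rewrite lt_neqAle eq_sym ne addr_ge0];
     rewrite // le_eqVlt; apply/orP; left; apply/eqP; ring.
have os1 : 0 <= 1 - on y * s.
  rewrite subr_ge0 /s ler_pdivrMr ?mulr_gt0 ?exprn_gt0 // mul1r expr2.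
  have o_n : on y <= n%:R by rewrite ler_nat -[leqRHS](nb_sum y) addnAC leq_addl.
  have n1 : 1 <= n%:R :> F by rewrite ler1n; lia.
  have : n%:R * 1 <= n%:R * n%:R :> F by rewrite ler_wpM2l // ltW.
  lra.
have z0 : 0 <= ze y by rewrite /ze.
have o0 : 0 <= on y by rewrite /on.
by rewrite /w; case: ifP => _; apply: divr_ge0 => //; rewrite addr_ge0 // ?mulr_ge0.
Qed.

(** From L_{n+2} on, |up y| <= |dn x| - 1, and uniform weights already give d/(d-1) >= 1 + 1/n for d
    = |dn x|. *)
Lemma expansion_high (F : realFieldType) A m : (n.+1 < m)%N -> A \subset lay m ->
  (1 + (64 * n%:R)^-1) * #|A|%:R <= #|shadow A|%:R :> F.
Proof.
move=> nm /subsetP AX; have n0 : 0 < n%:R :> F by rewrite ltr0n; lia.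
apply: (@weighted_expansion F _ (@cov n) (fun _ y : V => (#|up y|%:R)^-1 : F)) => [x xA|y _|x y _].
- have /eqP hr : rank x == m by rewrite -lay_rank AX.
  have ud : (#|up x| + 2 <= #|dn x|)%N by have := card_dn_up x; rewrite hr; lia.
  have d1 : (#|dn x| <= n)%N := card_dn_le x.
  pose d : F := #|dn x|%:R.
  have d2 : 2 <= d by rewrite (ler_nat _ 2); lia.
  have dn' : d <= n%:R by rewrite ler_nat.
  apply: (@le_trans _ _ (\sum_(y in dn x) (d - 1)^-1)).
    rewrite sumr_const -[leRHS]mulr_natl -/d ler_pdivlMr; last by lra.
    have : (64 * n%:R)^-1 * (d - 1) <= 1 by rewrite ler_pdivrMl ?mulr_gt0 //; lra.
    rewrite mulrDl mul1r; lra.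
  apply: ler_sum => y yx; rewrite lef_pV2 ?posrE; last by rewrite ltr0n (up_gt0 yx).
    rewrite /d lerBrDr natr1 ler_nat.
    by have := card_up_lower yx; lia.
  by lra.
- rewrite sumr_const -[leLHS]mulr_natl; have [->|u0] := posnP #|up y|.
    by rewrite mul0r.
  by rewrite divff // pnatr_eq0 -lt0n.
by rewrite invr_ge0.
Qed.

Lemma natr_expansion (F : realFieldType) (c a b : nat) : (0 < c)%N ->
  (1 + (64 * c%:R)^-1) * a%:R <= b%:R :> F -> ((64 * c + 1) * a <= 64 * c * b)%N.
Proof.
move=> c0; have c64 : 0 < 64 * c%:R :> F by rewrite mulr_gt0 // ltr0n.
rewrite -(ler_pM2l c64) mulrA mulrDr mulr1 divff ?lt0r_neq0 // => h.
by rewrite -(ler_nat F) !natrM natrD natrM.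
Qed.

Lemma expansion A m : (n < m)%N -> A \subset lay m ->
  ((64 * n + 1) * #|A| <= 64 * n * #|shadow A|)%N.
Proof.
move=> nm AX; apply: (@natr_expansion rat); first by apply: leq_trans n4.
have [mE|mn] := eqVneq m n.+1; first by apply: expansion_middle; rewrite -mE.
by apply: expansion_high AX; rewrite ltn_neqAle eq_sym mn.
Qed.
End GridExpansion.
End RealExpansion.

(** * Containers in a layer of the grid *)

(* Up-degrees from L_{m-1} are at least n/4 as long as 2(m-1) <= 3n; above that level
   they are at most half of the down-degrees, and a greedy cover suffices. *)
Definition layer_psi n L m := if 3 * n <= 2 * m.-1 then n %/ 16 else mid_psi L.

(** A factor 1 + 1/(64n) means a slack of at least g/(65n). For g > n^4 this exceeds the 40 b n^2
    that [container_middle] asks for. *)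
Lemma expansion_arith n b g a t :
  0 < n -> t = g - a -> (64 * n + 1) * a <= 64 * n * g -> n ^ 4 < g ->
  52 * 100 * b <= n -> g <= 65 * n * t /\ 40 * b * n ^ 2 <= t.
Proof.
move=> n0 -> h gn bn.
have ag : a <= g.
  rewrite -(@leq_pmul2l (64 * n)) ?muln_gt0 //; lia.
have h1 : a <= 64 * n * (g - a) by rewrite mulnBr; lia.
have h2 : g - a <= n * (g - a) by rewrite leq_pmull.
have h3 : g <= 65 * n * (g - a).
  by rewrite -{1}(subnK ag) (_ : 65 * n * _ = n * (g - a) + 64 * n * (g - a)) ?leq_add //; ring.
split => //.
rewrite -(@leq_pmul2l (65 * n)) ?muln_gt0 // (leq_trans _ h3) // (leq_trans _ (ltnW gn)) //.
rewrite (_ : 65 * n * _ = 2600 * b * (n * n ^ 2)); last by ring.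
rewrite (_ : n ^ 4 = n * (n * n ^ 2)); last by ring.
by rewrite leq_mul2r (leq_trans _ bn) ?orbT // leq_mul2r orbC.
Qed.

Section GridContainer.
Variables (n L : nat).
Hypothesis L_gt0 : 0 < L.
Hypothesis nL : 2 * n + 1 <= 2 ^ L.
Hypothesis reqL : requirement L <= n.
Local Notation V := (grid n).
Local Notation dn := (dn (@cov n)).
Local Notation up := (up (@cov n)).
Local Notation shadow := (shadow (@cov n)).
Implicit Types (x y : V) (A : {set V}).

Definition layer_container m := container (@cov n) (lay n m) (layer_psi n L m).

Lemma grid_container m A : n < m -> A \subset lay n m -> A != set0 ->
  exists (i : 'I_3) (s : 'I_5 -> {set V}),
    [/\ close_to (@cov n) s A, A \subset layer_container m i s &
      cert_cost L * \sum_j #|s j| + #|layer_container m i s|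
        + minn (#|shadow A| %/ 4) (n ^ 2) <= #|shadow A|].
Proof.
move=> nm AX A0; set b := cert_cost L; set g := #|shadow A|.
have [r1 r2 r3 r4] : [/\ 52 * 100 * good_loss L * mid_psi L * b <= n,
    52 * 100 * b <= n, 4 * (b + 1) * (4 * L + 1) <= n & 100 <= n].
  move: reqL; rewrite /requirement -/b.
  move: (52 * 100 * good_loss L * mid_psi L * b) (52 * 100 * b) (4 * (b + 1) * (4 * L + 1)).
  by move=> u v w h; split; lia.
have n0 : 0 < n by lia.
have b0 : 0 < b by rewrite /b /cert_cost; lia.
have xX x : x \in lay n m -> rank x = m by rewrite lay_rank => /eqP.
have hdn_le x : x \in lay n m -> #|dn x| <= n by move=> _; apply: card_dn_le.
have hdn_ge x : x \in lay n m -> n <= 2 * #|dn x|.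
  by move=> /xX hx; apply: leq_trans (rank_le_dn x); rewrite hx ltnW.
have hup x y : x \in lay n m -> y \in dn x -> #|up y| + m <= #|dn x| + n + 1.
  by move=> /xX hx /card_up_lower; have := card_dn_up x; rewrite hx; lia.
have hup_dn x y : x \in lay n m -> y \in dn x -> #|up y| <= #|dn x|.
  by move=> hx hy; have := hup _ _ hx hy; lia.
have clX : cl (@cov n) (lay n m) A \subset lay n m by apply: cl_sub.
(* A shadow of at most n^4 elements permits [small_set_expansion] with l = 4L+1. The expansion of
   order n/L then pays for listing [A]. *)
have [gs|gb] := leqP g (n ^ 4).
  have Ag : #|A| <= g by apply: (card_le_shadow n0 hdn_ge hup_dn).
  have n4 : n ^ 4 <= 2 ^ (4 * L).
    rewrite mulnC expnM leq_exp2r //; lia.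
  have [|i [s [h1 h2 h3]]] := @container_small V (@cov n) (lay n m) n n0 A b (layer_psi n L m) AX.
  - have : n * #|A| <= (4 * L + 1) * (#|A| + g).
      apply: small_set_expansion.
        by move=> x /(subsetP AX)/xX ->; apply: ltnW.
      by rewrite addn1 expnS; lia.
    move=> h; rewrite -(leq_pmul2l n0) mulnCA.
    apply: leq_trans (leq_mul (leqnn _) h) _.
    apply: (@leq_trans (2 * (b + 1) * ((4 * L + 1) * (2 * g)))).
      by rewrite !leq_mul2l; apply/orP; right; apply/orP; right; lia.
    rewrite (_ : _ * _ = 4 * (b + 1) * (4 * L + 1) * g); last by ring.
    by rewrite leq_mul2r r3 orbT.
  exists i, s; split => //; apply: leq_trans h3.
  by rewrite leq_add2l geq_minl.
have hexp := @expansion n _ _ m nm clX.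
rewrite (shadow_cl _ AX) -/g in hexp.
have n4 : 4 <= n by lia.
have [g65 t40] := expansion_arith n0 erefl (hexp n4) gb r2.
rewrite /layer_container /layer_psi; case: ifP => [high|/negbT low].
  have [|||i [s [h1 h2 h3]]] := @container_top V (@cov n) (lay n m) n n0 hdn_ge A b _ AX _ erefl.
  - have aux u d : u + m <= d + n + 1 -> d <= n -> 2 * u <= d by clear -high nm; lia.
    by move=> x y hx hy; apply: aux (hup _ _ hx hy) (hdn_le _ hx).
  - by lia.
  - by lia.
  exists i, s; split => //; apply: leq_trans h3.
  by rewrite leq_add2l geq_minl.
have [|||||||||||i [s [h1 h2 h3]]] := @container_middle V (@cov n) (lay n m) n n0 hdn_le hdn_ge hup_dn _ _
   A b (L + 6) (good_loss L) (mid_psi L) AX.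
- have aux u d r : d + n = u + r -> r <= 2 * d -> m = r.+1 -> n <= 4 * u.
    by clear -low nm => h1 h2 h3; move: low; rewrite h3 /=; lia.
  move=> x y hx hy; apply: aux (card_dn_up y) (rank_le_dn y) _.
  by rewrite -(rank_dn hy) (xX _ hx).
- by move=> x x' /xX hx /xX hx'; apply: codegree; rewrite hx hx'.
- by lia.
- by [].
- by rewrite addn_gt0 orbT.
- by [].
- by [].
- exact: r1.
- by rewrite expnD (_ : 2 ^ 6 = 64) //; lia.
- exact: t40.
- exact: g65.
exists i, s; split => //; apply: leq_trans h3.
by rewrite leq_add2l geq_minr.
Qed.

End GridContainer.

(** * Exchanging a cluster for its lower shadow *)

Lemma antichainP (d : Order.disp_t) (T : finPOrderType d) (A : {set T}) :
  reflect (forall x y, x \in A -> y \in A -> (x <= y)%O -> x = y) (antichain A).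
Proof.
apply: (iffP forall_inP) => [h x y xA yA xy|h x xA].
  apply/eqP; apply: contraT => ne; have /forall_inP/(_ _ yA) := h _ xA.
  by rewrite ne /= /Order.comparable xy.
apply/forall_inP => y yA; apply/implyP => ne.
rewrite /Order.comparable negb_or; apply/andP; split; apply: contra ne.
  by move=> /h -> //.
by move=> /h <- //.
Qed.

(** [adj] is reflexive, so a walk may wait at its end until it has the exact length that [linked]
    prescribes. *)
Lemma walk_pad (V : finType) (cv : rel V) (u : V) (p : seq V) m :
  path (adj cv) u p -> size p <= m ->
  exists q : m.-tuple V, path (adj cv) u q /\ {subset u :: p <= u :: q}.
Proof.
move=> pp pm; pose q := p ++ nseq (m - size p) (last u p).
have sq : size q == m by rewrite size_cat size_nseq subnKC.
exists (Tuple sq); split => /=.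
  rewrite cat_path pp /=; elim: (m - size p) => //= k ->.
  by rewrite adj_refl.
by move=> x; rewrite !inE mem_cat => /orP[->|->]; rewrite ?orbT.
Qed.

Lemma sum_le_cover (R : realDomainType) (I T : finType) (P : pred T)
    (Q : I -> pred T) (f : T -> R) :
  (forall x, (0 <= f x)%R) -> (forall x, P x -> exists c, Q c x) ->
  (\sum_(x | P x) f x <= \sum_c \sum_(x | P x && Q c x) f x)%R.
Proof.
move=> f0 PQ; rewrite (exchange_big_dep P) /=; last by move=> c x _ /andP[].
apply: ler_sum => x Px; have [c Qc] := PQ _ Px.
by rewrite (bigD1 c) ?Px //= lerDl sumr_ge0.
Qed.

Section Exchange.
Variables (n k j : nat).
Hypothesis jk : j <= k.
Local Notation V := (grid n).
Local Notation dn := (dn (@cov n)).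
Local Notation up := (up (@cov n)).
Local Notation shadow := (shadow (@cov n)).
Local Notation lay := (lay n).
Implicit Types (x y z v : V) (A B S W : {set V}).

(** Here the layer to be removed is L_{k+2}, clusters live in L_{k+2} and L_{k+1}, and the exchanged
    elements in L_k; no index is subtracted. *)
Definition slab a b : {set V} := [set x | a <= rank x <= b].

Definition families : {set {set V}} :=
  [set A | antichain A & A \subset slab j k.+2].

Definition low z := if rank z == k.+2 then shadow (dn z) else dn z.
Definition top W := W :&: lay k.+2.
(* mid W is the trace on L_{k+1} of the down-set generated by W. *)
Definition mid W := shadow (top W) :|: (W :&: lay k.+1).

Lemma lowP z y : z \in lay k.+2 :|: lay k.+1 ->
  reflect ((y <= z)%O /\ rank y = k) (y \in low z).
Proof.
move=> zL; rewrite /low; apply: (iffP idP); case: ifPn => [/eqP z2|z2].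
- move=> /shadowP[x xz yx]; split; first exact: le_trans (le_dn yx) (le_dn xz).
  by have := rank_dn xz; have := rank_dn yx; rewrite z2 => -> [].
- move=> yz; split; first exact: le_dn.
  move: zL; rewrite in_setU !lay_rank (negbTE z2) /= => /eqP z1.
  by have := rank_dn yz; rewrite z1 => -[].
- move=> [yz yk]; have [|i z0 yl] := lt_lower yz; first by rewrite z2 yk ltnW.
  apply/shadowP; exists (lower i z); first by apply/dnP; exists i.
  apply: mem_dn_le yl _; rewrite yk.
  by have := rank_lower z0; rewrite z2 => -[].
- move=> [yz yk]; apply: mem_dn_le => //.
  by move: zL; rewrite in_setU !lay_rank (negbTE z2) /= yk => /eqP.
Qed.

Lemma reach_low z y : y \in low z -> reach (@cov n) 2 z y.
Proof.
rewrite /low; case: ifP => _.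
  by case/shadowP => x xz yx; apply: reach_trans (reach_dn xz) (reach_dn yx).
by move=> yz; apply: (@reach_leq _ _ 1) => //; apply: reach_dn.
Qed.

Lemma shadow_midP W y : W \subset lay k.+2 :|: lay k.+1 ->
  reflect (exists2 z, z \in W & y \in low z) (y \in shadow (mid W)).
Proof.
move=> /subsetP WL; apply: (iffP (shadowP _ _ _)) => [[x + yx]|[z zW]].
  rewrite in_setU => /orP[/shadowP[z]|]; rewrite in_setI lay_rank.
    by move=> /andP[zW z2] xz; exists z => //; rewrite /low z2; apply/shadowP; exists x.
  move=> /andP[xW /eqP x1]; exists x => //.
  by rewrite /low x1 eqn_leq ltnn andbF.
rewrite /low; case: ifPn => [z2 /shadowP[x xz yx]|z2 yz].
  exists x => //; rewrite in_setU; apply/orP; left; apply/shadowP; exists z => //.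
  by rewrite in_setI zW lay_rank.
exists z => //; rewrite in_setU in_setI zW /=; apply/orP; right.
by move: (WL _ zW); rewrite in_setU lay_rank (negbTE z2).
Qed.

Definition link A : rel V :=
  [rel x y | [&& x \in A :&: (lay k.+2 :|: lay k.+1),
                 y \in A :&: (lay k.+2 :|: lay k.+1) & ~~ [disjoint low x & low y]]].

Definition cluster v A := [set z | connect (link A) v z].

Lemma cluster_self v A : v \in cluster v A.
Proof. by rewrite inE connect0. Qed.

Lemma cluster_sub v A : v \in A -> v \in lay k.+2 ->
  cluster v A \subset A :&: (lay k.+2 :|: lay k.+1).
Proof.
move=> vA vk; apply/subsetP => z; rewrite inE => /connectP[p + ->].
case/lastP: p => [|p w] /=; first by rewrite in_setI vA in_setU vk.
by rewrite rcons_path last_rcons => /andP[_ /and3P[]].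
Qed.

Lemma cluster_link v A x y : x \in cluster v A -> link A x y -> y \in cluster v A.
Proof. by rewrite !inE => vx xy; apply: connect_trans vx (connect1 xy). Qed.

Lemma cluster_connected v A B : v \in B -> B \subset cluster v A ->
  B != cluster v A ->
  exists x y, [/\ x \in B, y \in cluster v A :\: B & ~~ [disjoint low x & low y]].
Proof.
move=> vB BC ne.
have /subsetPn[z zC zB] : ~~ (cluster v A \subset B).
  by apply: contra ne => CB; rewrite eqEsubset BC.
move: zC; rewrite inE => /connectP[p pp ez].
have {ez zB} : last v p \notin B by rewrite -ez.
elim/last_ind: p pp => [|p w IH] /=; first by rewrite vB.
rewrite rcons_path last_rcons => /andP[pp lw] wB.
case: (boolP (last v p \in B)) => [lB|]; last exact: IH.
exists (last v p), w; split=> //; last by case/and3P: lw.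
rewrite in_setD wB inE; apply: connect_trans (connect1 lw).
by apply/connectP; exists p.
Qed.

(** With [G] the shadow of [mid W], each element of [G] lies strictly below a member of [W], hence
    outside [A]. So [S] is the trace of (A \ W) u S on [G], and [A] is recovered by exchanging this
    trace for [W]. *)
Lemma exchange v W : v \in lay k.+2 ->
  #|[set A in families | (v \in A) && (cluster v A == W)]| * 2 ^ #|shadow (mid W)|
    <= #|families|.
Proof.
move=> vk; set F := [set A in families | _]; set G := shadow (mid W).
pose f (AS : {set V} * {set V}) := (AS.1 :\: W) :|: AS.2.
have FP A : A \in F ->
  [/\ antichain A, A \subset slab j k.+2, v \in A, W = cluster v A &
      W \subset A :&: (lay k.+2 :|: lay k.+1)].
  rewrite !inE => /andP[/andP[aA sA] /andP[vA /eqP <-]]; split => //.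
  exact: cluster_sub.
have GP A y : A \in F -> y \in G -> exists z,
    [/\ z \in W, z \in A, y \in low z, (y <= z)%O & rank y = k /\ k < rank z].
  move=> /FP[_ _ _ _ WA] yG.
  have WL : W \subset lay k.+2 :|: lay k.+1 := subset_trans WA (subsetIr _ _).
  have [z zW yz] := shadow_midP y WL yG; have zL := subsetP WL _ zW.
  have [le hr] := lowP _ zL yz.
  exists z; split => //; first by have := subsetP WA _ zW; rewrite in_setI => /andP[].
  split => //; move: zL; rewrite in_setU !lay_rank.
  by case/orP => /eqP ->.
have GA A y : A \in F -> y \in G -> y \notin A.
  move=> AF yG; have [z [zW zA _ yz [yk zk]]] := GP _ _ AF yG.
  have [/antichainP aA _ _ _ _] := FP _ AF.
  by apply/negP => yA; move: zk; rewrite -yk (aA _ _ yA zA yz) ltnn.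
have inj : {in setX F (powerset G) &, injective f}.
  move=> [A S] [A' S'] /=; rewrite !in_setX /= !powersetE => /andP[AF SG] /andP[AF' SG'] e.
  have dec A0 S0 : A0 \in F -> S0 \subset G ->
      f (A0, S0) :&: G = S0 /\ (f (A0, S0) :\: G) :|: W = A0.
    move=> A0F S0G; have [_ _ _ _ /subsetP WA] := FP _ A0F.
    split; apply/setP => y; rewrite /f /= !(in_setU, in_setI, in_setD).
      case: (boolP (y \in G)) => [yG|yG]; rewrite ?andbT ?andbF.
        by rewrite (negbTE (GA _ _ A0F yG)) andbF.
      by apply/esym/negbTE; apply: contra yG; apply: (subsetP S0G).
    case: (boolP (y \in W)) => [/WA|yW]; first by rewrite in_setI orbT => /andP[->].
    rewrite orbF /=; case: (boolP (y \in G)) => [yG|yG] /=.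
      by rewrite (negbTE (GA _ _ A0F yG)).
    have -> : (y \in S0) = false by apply: contraNF yG; apply: (subsetP S0G).
    by rewrite orbF.
  have [e1 e2] := dec _ _ AF SG; have [e1' e2'] := dec _ _ AF' SG'.
  by rewrite e in e1 e2; rewrite -[A]e2 -[S]e1 e2' e1'.
rewrite -card_powerset -cardsX -(card_in_imset inj).
apply: subset_leq_card; apply/subsetP => _ /imsetP[[A S] + ->].
rewrite in_setX /= powersetE => /andP[AF /subsetP SG].
have [/antichainP aA /subsetP sA vA WE /subsetP WA] := FP _ AF.
(* An element of [A] strictly above [s] lies in L_{k+1} or L_{k+2} and shares the lower bound [s]
   with a member of [W], so it belongs to the cluster. One below [s] lies below a member of [W]. *)
have cross a s : a \in A -> a \notin W -> s \in S -> ~~ (a <= s)%O && ~~ (s <= a)%O.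
  move=> aA' aW sS; have sG := SG _ sS.
  have [z [zW zA sz les [sk zk]]] := GP _ _ AF sG.
  apply/andP; split; apply/negP => le.
    by move/negP: aW; apply; rewrite (aA _ _ aA' zA (le_trans le les)).
  have lt : k < rank a.
    rewrite ltnNge; apply/negP => ak; have sa := eq_rank le; rewrite sk in sa.
    by move: (GA _ _ AF sG); rewrite (sa ak) aA'.
  have aL : a \in lay k.+2 :|: lay k.+1.
    rewrite in_setU !lay_rank; have := sA _ aA'; rewrite inE => /andP[_ a2].
    by move: (rank a) lt a2 => r; clear; lia.
  move/negP: aW; apply; rewrite WE; apply: (@cluster_link _ _ z); first by rewrite -WE.
  rewrite /link /= WA // in_setI aA' aL /=; apply/pred0Pn; exists s => /=.
  by rewrite sz; apply/lowP.
rewrite inE /f /=; apply/andP; split.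
  apply/antichainP => x y; rewrite !in_setU !in_setD.
  move=> /orP[/andP[xW xA]|xS] /orP[/andP[yW yA]|yS] xy.
  - exact: aA.
  - by have /andP[/negP[]] := cross _ _ xA xW yS.
  - by have /andP[_ /negP[]] := cross _ _ yA yW xS.
  - have [_ [_ _ _ _ [xk _]]] := GP _ _ AF (SG _ xS).
    have [_ [_ _ _ _ [yk _]]] := GP _ _ AF (SG _ yS).
    by apply: eq_rank xy _; rewrite xk yk.
rewrite subUset (subset_trans (subsetDl _ _)) /=; last exact/subsetP.
apply/subsetP => s /SG sG; have [z [_ _ _ _ [sk _]]] := GP _ _ AF sG.
by rewrite inE sk jk ltnW.
Qed.

Lemma mid_sub W : mid W \subset lay k.+1.
Proof.
rewrite subUset subsetIr andbT; apply/subsetP => y /shadowP[x].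
by rewrite in_setI !lay_rank => /andP[_ /eqP x2] yx; have := rank_dn yx; rewrite x2 => -[->].
Qed.

Definition clusters v := cluster v @: [set A in families | v \in A].

Lemma card_families_mem v (F : realFieldType) : v \in lay k.+2 ->
  (#|[set A in families | v \in A]|%:R <=
    #|families|%:R * \sum_(W in clusters v) 2 ^- #|shadow (mid W)| :> F)%R.
Proof.
move=> vk.
rewrite -sum1_card (partition_big_imset (cluster v)) /= natr_sum mulr_sumr.
apply: ler_sum => W _; rewrite ler_pdivlMr ?exprn_gt0 //.
rewrite -natrX -natrM ler_nat (leq_trans _ (exchange W vk)) // leq_mul2r.
apply/orP; right; rewrite -sum1_card; apply: eq_leq; apply: eq_bigl => A.
by rewrite [in RHS]inE [A \in [set _ in families | _]]inE andbA.
Qed.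

(** The disjointness expresses that [A] is an antichain. The distance 4 is at most two steps down to
    a common lower bound and at most two up. *)
Lemma clusterP v W : v \in lay k.+2 -> W \in clusters v ->
  [/\ v \in W, W \subset lay k.+2 :|: lay k.+1,
      [disjoint W :&: lay k.+1 & shadow (top W)] &
      forall B, B \subset W -> v \in B -> B != W ->
        exists x y, [/\ x \in B, y \in W :\: B & reach (@cov n) 4 x y]].
Proof.
move=> vk /imsetP[A + ->]; rewrite inE => /andP[]; rewrite inE => /andP[aA sA] vA.
have CA := cluster_sub vA vk.
split.
- exact: cluster_self.
- exact: subset_trans CA (subsetIr _ _).
- apply/pred0Pn => -[x /andP[/= /setIP[xC x1] /shadowP[z /setIP[zC z2] xz]]].
  have xA : x \in A by have := subsetP CA _ xC; rewrite in_setI => /andP[].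
  have zA : z \in A by have := subsetP CA _ zC; rewrite in_setI => /andP[].
  have := rank_dn xz; rewrite (antichainP _ aA _ _ xA zA (le_dn xz)).
  by move/eqP; rewrite eqn_leq ltnn andbF.
- move=> B BC vB ne; have [x [y [xB yB /pred0Pn[w /andP[/= wx wy]]]]] := cluster_connected vB BC ne.
  exists x, y; split => //.
  exact: reach_trans (reach_low wx) (reach_sym (reach_low wy)).
Qed.

End Exchange.

(** * Summing over clusters *)

Section ClusterSum.
Variables (n L k j : nat).
Hypothesis L_gt0 : 0 < L.
Hypothesis nL : 2 * n + 1 <= 2 ^ L.
Hypothesis reqL : requirement L <= n.
Hypothesis nk : n <= k.
Hypothesis jk : j <= k.
Local Notation V := (grid n).
Local Notation dn := (dn (@cov n)).
Local Notation shadow := (shadow (@cov n)).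
Local Notation lay := (lay n).
Local Notation top := (@top n k).
Local Notation mid := (@mid n k).
Implicit Types (x y z v : V) (A B S W : {set V}).

Local Notation J := (bool * 'I_5)%type.

(** [true] marks the certificate of [top W], [false] that of [mid W], and the index is the slot.
    Joined into one labelled set, both are visited by a single walk. *)
Definition slice (Z : {set J * V}) c (i : 'I_5) : {set V} := [set x | (c, i, x) \in Z].

Definition join_cert (s1 s2 : 'I_5 -> {set V}) : {set J * V} :=
  [set z | z.2 \in (if z.1.1 then s1 else s2) z.1.2].

Lemma card_slice Z : \sum_i #|slice Z true i| + \sum_i #|slice Z false i| = #|Z|.
Proof.
rewrite -[RHS]sum1_card (partition_big (fun z : J * V => z.1) xpredT) //=.
rewrite -(pair_big xpredT xpredT (fun c i => \sum_(z in Z | z.1 == (c, i)) 1)) /=.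
have fib c i : #|slice Z c i| = \sum_(z in Z | z.1 == (c, i)) 1.
  rewrite sum1_card -(card_imset (slice Z c i) (_ : injective (pair (c, i)))); last by move=> x y [].
  apply: eq_card => -[[c' i'] x]; rewrite [RHS]inE /=; apply/imsetP/andP.
    by case=> y; rewrite inE => h [-> -> ->].
  by case=> h /eqP[e1 e2]; exists x; rewrite ?inE -?e1 -?e2.
by rewrite big_bool /=; congr (_ + _); apply: eq_bigr => i _.
Qed.

Lemma slice_join s1 s2 c i : slice (join_cert s1 s2) c i = (if c then s1 else s2) i.
Proof. by apply/setP => x; rewrite !inE /=. Qed.

Local Notation b := (cert_cost L).
Local Notation cont := (@layer_container n L).

(** A lower bound for the minimum in [grid_container], since the shadow of [mid W] has at least
    n^2/8 elements by [card_shadow2]. *)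
Definition gain := n ^ 2 %/ 32.

(** [gain] is asked only of [mid W], whose shadow is what the exchange frees; the inequality for
    [top W] merely pays for the choice of [top W]. *)
Definition certified (c : 'I_3 * 'I_3 * {set J * V}) W :=
  [&& top W \subset cont k.+2 c.1.1 (slice c.2 true),
      mid W \subset cont k.+1 c.1.2 (slice c.2 false),
      b * \sum_i #|slice c.2 true i| + #|cont k.+2 c.1.1 (slice c.2 true)|
        <= #|shadow (top W)| &
      b * \sum_i #|slice c.2 false i| + #|cont k.+1 c.1.2 (slice c.2 false)| + gain
        <= #|shadow (mid W)|].

Lemma container_ext m i (s s' : 'I_5 -> {set V}) : s =1 s' -> cont m i s = cont m i s'.
Proof.
move=> e; rewrite /layer_container /container /psi_container /cert_shadow !e.
by case: (nat_of_ord i) => [|[|?]] //.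
Qed.

Lemma cluster_certified v W : v \in lay k.+2 -> W \in clusters k j v ->
  exists c, certified c W && linked (@cov n) v (24 * #|c.2|) c.2.
Proof.
move=> vk hW; have [vW WL _ conn] := clusterP vk hW.
have vT : v \in top W by rewrite in_setI vW vk.
have n0 : 0 < n by move: reqL; rewrite /requirement; lia.
have rv : rank v = k.+2 by apply/eqP; rewrite -lay_rank.
have T0 : top W != set0 by apply/set0Pn; exists v.
have M0 : mid W != set0.
  have /card_gt0P[x xv] : 0 < #|dn v| by have := rank_le_dn v; rewrite rv; lia.
  by apply/set0Pn; exists x; rewrite in_setU; apply/orP; left; apply/shadowP; exists v.
have nk2 : n < k.+2 by apply: ltnW.
have [i1 [s1 [[n11 n12] c1 h1]]] := grid_container L_gt0 nL reqL nk2 (subsetIr W (lay k.+2)) T0.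
have nk1 : n < k.+1 by [].
have [i2 [s2 [[n21 n22] c2 h2]]] := grid_container L_gt0 nL reqL nk1 (@mid_sub n k W) M0.
have g0 : n ^ 2 <= 8 * #|shadow (mid W)|.
  apply: leq_trans (card_shadow2 n0 (_ : n < rank v)) _; first by rewrite rv.
  rewrite leq_mul2l /=; apply: subset_leq_card; apply: shadowS.
  by apply: subset_trans (subsetUl _ _); apply: dn_sub_shadow.
pose Z := join_cert s1 s2.
have e1 : slice Z true =1 s1 by move=> i; rewrite slice_join.
have e2 : slice Z false =1 s2 by move=> i; rewrite slice_join.
exists (i1, i2, Z); apply/andP; split.
  rewrite /certified /= (container_ext _ _ e1) (container_ext _ _ e2) c1 c2 /=.
  rewrite (eq_bigr (fun i => #|s1 i|)); last by move=> i _; rewrite e1.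
  rewrite (eq_bigr (fun i => #|s2 i|) (fun i _ => congr1 (fun A : {set V} => #|A|) (e2 i))).
  rewrite (leq_trans (leq_addr _ _) h1) /= (leq_trans _ h2) // leq_add2l leq_min.
  rewrite /gain leq_div andbT leq_divRL //.
  by have := leq_trunc_div (n ^ 2) 32; move: (n ^ 2) g0 => u; clear; lia.
have MW x : x \in mid W -> exists2 a, a \in W & reach (@cov n) 1 x a.
  rewrite in_setU => /orP[/shadowP[a]|]; rewrite in_setI => /andP[xW _].
    by move=> xa; exists a => //; apply/reach_sym/reach_dn.
  by exists x => //; apply: reach_refl.
pose S := (fun z : J * V => z.2) @: Z.
have SZ z : z \in S -> (exists i, z \in s1 i) \/ (exists i, z \in s2 i).
  case/imsetP => -[[c i] x]; rewrite inE /= => + ->.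
  by case: c => h; [left|right]; exists i.
have S1 z i : z \in s1 i -> z \in S.
  by move=> zs; apply/imsetP; exists ((true, i), z); rewrite ?inE.
have S2 z i : z \in s2 i -> z \in S.
  by move=> zs; apply/imsetP; exists ((false, i), z); rewrite ?inE.
(* Certificates are within 3 of [top W] or [mid W], and [mid W] is within 1 of [W], so r = 4. Links
   have length d = 4, which makes 2(2r+d) = 24 steps per vertex. *)
have [z|a aW|p [pp sp Sp]] := @walk_cover _ (@cov n) v W S 4 4 vW conn.
- case/SZ => -[i zi].
    have [a] := n11 _ _ zi; rewrite in_setI => /andP[aW _] za.
    by exists a => //; apply: reach_leq za.
  have [x xM zx] := n21 _ _ zi; have [a aW xa] := MW _ xM.
  by exists a => //; apply: reach_trans zx xa.
- have := subsetP WL _ aW; rewrite in_setU => /orP[aL|aL].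
    have [|i [z zi az]] := n12 a; first by rewrite in_setI aW.
    by exists z; [apply: S1 zi|apply: reach_leq az].
  have [|i [z zi az]] := n22 a; first by rewrite in_setU in_setI aW aL orbT.
  by exists z; [apply: S2 zi|apply: reach_leq az].
have [|q [pq subq]] := @walk_pad V (@cov n) v p (24 * #|Z|) pp.
  by rewrite sp leq_mul2l /= leq_imset_card.
apply/existsP; exists q; rewrite pq; apply/forall_inP => z zZ.
by apply/subq/Sp/imset_f.
Qed.

(* A cluster W is determined by C = top W and W n L_{k+1}; since the latter avoids the
   shadow of C, there are only 2^(|S2| - |shadow C|) choices for it, and this pays for
   the choice of C in its own container. *)
Lemma card_certified v c : v \in lay k.+2 ->
  #|[set W in clusters k j v | certified c W]| * 2 ^ (b * \sum_i #|slice c.2 true i|)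
    <= 2 ^ #|cont k.+1 c.1.2 (slice c.2 false)|.
Proof.
move=> vk; set Q := [set W in _ | _]; set c1 := b * _.
set S1 := cont k.+2 c.1.1 (slice c.2 true); set S2 := cont _ _ _.
have QP W : W \in Q -> [/\ W \in clusters k j v, top W \subset S1, mid W \subset S2
    & c1 + #|S1| <= #|shadow (top W)|].
  by rewrite inE => /andP[h1 /and4P[]].
have fib C : C \in powerset S1 ->
    #|[set W in Q | top W == C]| * 2 ^ (c1 + #|S1|) <= 2 ^ #|S2|.
  move=> _; have [->|[W0]] := set_0Vmem [set W in Q | top W == C].
    by rewrite cards0 mul0n.
  rewrite inE => /andP[/QP[_ _ M0 h0] /eqP C0]; rewrite C0 in h0.
  have CS2 : shadow C \subset S2.
    by rewrite -C0; apply: subset_trans M0; apply: subsetUl.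
  have sub : (fun W => W :&: lay k.+1) @: [set W in Q | top W == C] \subset
      powerset (S2 :\: shadow C).
    apply/subsetP => _ /imsetP[W + ->]; rewrite inE => /andP[/QP[hW _ MW _] /eqP CW].
    have [_ _ dis _] := clusterP vk hW; rewrite powersetE subsetD -CW dis andbT.
    by apply: subset_trans MW; apply: subsetUr.
  have inj : {in [set W in Q | top W == C] &, injective (fun W => W :&: lay k.+1)}.
    move=> W W'; rewrite !inE => /andP[/andP[hW _] /eqP CW] /andP[/andP[hW' _] /eqP CW'] e.
    have [_ WL _ _] := clusterP vk hW; have [_ WL' _ _] := clusterP vk hW'.
    by rewrite -(setIidPl WL) -(setIidPl WL') !setIUr e -/(top W) -/(top W') CW CW'.
  apply: leq_trans (_ : 2 ^ (#|S2| - #|shadow C|) * 2 ^ (c1 + #|S1|) <= _).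
    rewrite leq_mul2r -(card_in_imset inj) (leq_trans (subset_leq_card sub)) ?orbT //.
    by rewrite card_powerset leq_exp2l // cardsD (setIidPr CS2).
  rewrite -expnD leq_exp2l // -[leqRHS](subnK (subset_leq_card CS2)) leq_add2l //.
have : #|Q| * 2 ^ (c1 + #|S1|) <= 2 ^ #|S1| * 2 ^ #|S2|.
  rewrite -sum1_card (partition_big (top : {set V} -> {set V}) (mem (powerset S1))) /=; last first.
    by move=> W /QP[_ h _ _]; rewrite powersetE.
  rewrite big_distrl /= -card_powerset -sum_nat_const; apply: leq_sum => C /fib.
  by apply: leq_trans; rewrite leq_mul2r -sum1_card; apply/orP; right; apply: eq_leq;
     apply: eq_bigl => W; rewrite [in RHS]inE.
by rewrite expnD mulnA [_ * 2 ^ #|S1|]mulnC leq_pmul2l ?expn_gt0.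
Qed.

Local Open Scope ring_scope.

(** A certificate of cost c1 + c2 serves at most 2^(s2 - c1) clusters, each of weight at most 2^-(c2
    + s2 + gain), so the container size s2 cancels. The factor 9 counts pairs of modes, and 2^11 is
    2^(|J|+1) from [sum_linked]. *)
Lemma sum_clusters (F : realFieldType) v : v \in lay k.+2 ->
  \sum_(W in clusters k j v) (2 ^- #|shadow (mid W)| : F) <=
    9 * 2 ^+ 11 * 2 ^- gain.
Proof.
move=> vk.
have p2 m : 0 < (2 : F) ^+ m by rewrite exprn_gt0.
pose Q (c : 'I_3 * 'I_3 * {set J * V}) W :=
  certified c W && linked (@cov n) v (24 * #|c.2|) c.2.
apply: le_trans (@sum_le_cover _ _ _ _ Q _ _ _) _.
- by move=> W; rewrite invr_ge0 ltW.
- by move=> W hW; apply: cluster_certified.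
apply: (@le_trans _ _ (\sum_(c : 'I_3 * 'I_3 * {set J * V} | linked (@cov n) v (24 * #|c.2|) c.2)
   (2 ^- (b * #|c.2|) * 2 ^- gain))).
  rewrite [leRHS]big_mkcond; apply: ler_sum => c _; case: ifPn => [lc|lc]; last first.
    by rewrite big1 // => W /andP[_ /andP[_]]; rewrite (negbTE lc).
  set c1 := (b * \sum_i #|slice c.2 true i|)%N.
  set c2 := (b * \sum_i #|slice c.2 false i|)%N.
  have -> : (b * #|c.2| = c1 + c2)%N by rewrite -card_slice mulnDr.
  set s2 := #|cont k.+1 c.1.2 (slice c.2 false)|.
  apply: (@le_trans _ _ (\sum_(W in [set W in clusters k j v | certified c W])
      2 ^- (c2 + s2 + gain))).
    rewrite (eq_bigl (fun W => W \in [set W in clusters k j v | certified c W])); last first.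
      by move=> W; rewrite inE /Q lc andbT.
    apply: ler_sum => W; rewrite inE => /andP[_ /and4P[_ _ _ h]].
    by rewrite lef_pV2 ?posrE // ler_eXn2l // ltr1n.
  rewrite sumr_const -[leLHS]mulr_natl ler_pdivrMr //.
  have := card_certified c vk; rewrite -/c1 -/s2; set q := #|_| => hq.
  rewrite -invfM -!exprD mulrC ler_pdivlMr // -!natrX -natrM ler_nat.
  rewrite (_ : c2 + s2 + gain = s2 + (c2 + gain))%N; last by lia.
  by rewrite -addnA !expnD mulnA leq_mul2r hq orbT.
rewrite -mulr_suml ler_wpM2r //; first by rewrite invr_ge0 ltW.
rewrite (eq_bigl (fun c : 'I_3 * 'I_3 * {set J * V} => xpredT c.1 && linked (@cov n) v (24 * #|c.2|) c.2)) //.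
rewrite -(pair_big xpredT (fun Z : {set J * V} => linked (@cov n) v (24 * #|Z|) Z)
   (fun _ Z => 2 ^- (b * #|Z|))) /= sumr_const card_prod card_ord.
have h := @sum_linked V (@cov n) J F v (2 * n + 1) 24 b (@card_adj n) _.
rewrite -[(3 * 3)%N]/9%N -[leLHS]mulr_natl ler_wpM2l //.
have cJ : #|{: J}| = 10%N by rewrite card_prod card_bool card_ord.
rewrite cJ in h; apply: h.
(* The exponent 24L + 241 is at most 300L, the value of [cert_cost], because L >= 1. *)
apply: (@leq_trans (2 ^ (L * 24) * 2 ^ (10 * 24 + 1))).
  by rewrite leq_mul2r expnM leq_exp2r ?nL ?orbT.
by rewrite -expnD leq_exp2l // /cert_cost; move: L_gt0; clear; lia.
Qed.

Lemma natr_bound (F : realFieldType) (a c d e g : nat) :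
  a%:R <= c%:R * (d%:R * 2 ^+ e * 2 ^- g) :> F -> (a * 2 ^ g <= d * 2 ^ e * c)%N.
Proof.
have p2 : 0 < (2 : F) ^+ g by rewrite exprn_gt0.
rewrite mulrA ler_pdivlMr // => h.
by rewrite -(ler_nat F) !natrM !natrX [leRHS]mulrC.
Qed.

Lemma card_families_mem_le v : v \in lay k.+2 ->
  (#|[set A in families n k j | v \in A]| * 2 ^ gain <= 9 * 2 ^ 11 * #|families n k j|)%N.
Proof.
move=> vk; apply: (@natr_bound rat).
have h1 := card_families_mem jk rat vk.
exact: le_trans h1 (ler_wpM2l (ler0n rat #|families n k j|) (sum_clusters rat vk)).
Qed.

End ClusterSum.

(** * Peeling off the layers *)

Lemma nb_antichainsS (d : Order.disp_t) (T : finPOrderType d) (S S' : {set T}) :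
  S \subset S' -> nb_antichains S <= nb_antichains S'.
Proof.
move=> SS'; apply: subset_leq_card; apply/subsetP => A.
by rewrite !inE => /andP[-> /subset_trans]; apply.
Qed.

Lemma nb_antichains_gt0 (d : Order.disp_t) (T : finPOrderType d) (S : {set T}) :
  0 < nb_antichains S.
Proof.
apply/card_gt0P; exists set0; rewrite inE sub0set andbT.
by apply/antichainP => x y; rewrite inE.
Qed.

Section Peeling.
Variables (n L : nat).
Hypothesis L_gt0 : 0 < L.
Hypothesis nL : 2 * n + 1 <= 2 ^ L.
Hypothesis reqL : requirement L <= n.
Local Notation V := (grid n).
Local Notation lay := (lay n).
Local Notation slab := (@slab n).
Implicit Types (x y v : V) (A : {set V}).

Definition peel_error := 3 ^ n * (9 * 2 ^ 11).

(** Union bound over the elements [v] of L_{k+2}, of which there are at most 3^n. *)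
Lemma peel j k : n <= k -> j <= k ->
  nb_antichains (slab j k.+2) * 2 ^ gain n <=
    nb_antichains (slab j k.+1) * 2 ^ gain n + peel_error * nb_antichains (slab j k.+2).
Proof.
move=> nk jk.
have h : nb_antichains (slab j k.+2) <= nb_antichains (slab j k.+1) +
    \sum_(v in lay k.+2) #|[set A in families n k j | v \in A]|.
  apply: (@leq_trans #|[set A : {set V} | antichain A & A \subset slab j k.+1] :|:
      \bigcup_(v in lay k.+2) [set A in families n k j | v \in A]|).
    apply: subset_leq_card; apply/subsetP => A; rewrite inE => /andP[aA sA].
    rewrite in_setU inE aA /=; case: (boolP (A \subset slab j k.+1)) => //= /subsetPn[v vA vs].
    have vk : v \in lay k.+2.
      move: vs; have := subsetP sA _ vA; rewrite !inE => /andP[-> h2] /=.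
      by move: (rank v) h2 => r; clear; lia.
    by apply/bigcupP; exists v; rewrite // !inE aA sA.
  apply: leq_trans (leq_card_setU _ _) _; rewrite leq_add2l.
  elim/big_rec2: _ => [|v s B _ hB]; first by rewrite cards0.
  by rewrite (leq_trans (leq_card_setU _ _)) // leq_add.
apply: leq_trans (leq_mul h (leqnn _)) _; rewrite mulnDl leq_add2l big_distrl /=.
apply: (@leq_trans (\sum_(v in lay k.+2) 9 * 2 ^ 11 * nb_antichains (slab j k.+2))).
  apply: leq_sum => v vk.
  exact: (card_families_mem_le L_gt0 nL reqL nk jk vk).
rewrite sum_nat_const /peel_error mulnA !leq_mul2r; apply/orP; right; apply/orP; right.
by rewrite (leq_trans (max_card _)) // card_tuple card_ord.
Qed.

Lemma slabS j k k' : k <= k' -> slab j k \subset slab j k'.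
Proof.
move=> kk'; apply/subsetP => x; rewrite !inE => /andP[-> xk] /=.
exact: leq_trans xk kk'.
Qed.

(** The errors of all [m] layers are measured against the largest slab, so they simply add up. *)
Lemma peel_all j m : j <= n ->
  nb_antichains (slab j (n.+1 + m)) * 2 ^ gain n <=
    nb_antichains (slab j n.+1) * 2 ^ gain n
      + m * peel_error * nb_antichains (slab j (n.+1 + m)).
Proof.
move=> jn; elim: m => [|m IH]; first by rewrite addn0 !mul0n addn0.
have nm : n <= n + m := leq_addr _ _.
rewrite addnS addSn; rewrite addSn in IH.
apply: leq_trans (peel nm (leq_trans jn nm)) _.
apply: leq_trans (leq_add IH (leqnn _)) _.
rewrite -addnA leq_add2l mulSn mulnDl addnC leq_add2l leq_mul2l.
by rewrite nb_antichainsS ?orbT // slabS.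
Qed.

(** * Order reversal *)

Definition compl x : V := of_digit (fun i => 2 - digit x i).

Lemma digit_compl x i : digit (compl x) i = 2 - digit x i.
Proof. by rewrite digit_of // ltnS leq_subr. Qed.

Lemma complK : involutive compl.
Proof.
move=> x; apply: digit_inj => i; rewrite !digit_compl.
by have := digit_lt3 x i; case: (digit x i) => [|[|[|]]].
Qed.

Lemma le_compl x y : (compl x <= compl y)%O -> (y <= x)%O.
Proof.
move=> /leP_digit h; apply/leP_digit => i; have := h i; rewrite !digit_compl.
have := digit_lt3 x i; have := digit_lt3 y i.
by case: (digit x i) => [|[|[|]]] //; case: (digit y i) => [|[|[|]]].
Qed.

Lemma rank_compl x : rank (compl x) + rank x = 2 * n.
Proof.
rewrite /rank -big_split /= (eq_bigr (fun=> 2)).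
  by rewrite sum_nat_const card_ord mulnC.
move=> i _; rewrite digit_compl subnK // -ltnS; exact: digit_lt3.
Qed.

(** Complementation sends the ranks 0, ..., n+1 to n-1, ..., 2n, so that the lower layers, too, are
    peeled from above. The bound n.+1 + n is 2n+1, which exceeds every rank. *)
Lemma nb_antichains_flip :
  nb_antichains (slab 0 n.+1) <= nb_antichains (slab n.-1 (n.+1 + n)).
Proof.
rewrite /nb_antichains -(card_imset _ (imset_inj (inv_inj complK))).
apply: subset_leq_card; apply/subsetP => _ /imsetP[A + ->].
rewrite !inE => /andP[/antichainP aA /subsetP sA]; apply/andP; split.
  apply/antichainP => _ _ /imsetP[x xA ->] /imsetP[y yA ->] /le_compl yx.
  by rewrite (aA _ _ yA xA yx).
apply/subsetP => _ /imsetP[x /sA + ->]; rewrite !inE.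
by have := rank_compl x; move: (rank x) (rank (compl x)) => r r'; clear; lia.
Qed.

End Peeling.

(** [a], [b], [c] bound the counts before, between and after the two rounds of peeling. With H = 2^h
    the two errors together are at most a/(2H), so a <= c 2H/(2H-1) <= c(1 + 1/H). *)
Lemma ratio_arith a b c g E n h :
  b <= a -> a * 2 ^ g <= b * 2 ^ g + n * E * a -> b * 2 ^ g <= c * 2 ^ g + n * E * b ->
  4 * n * E * 2 ^ h <= 2 ^ g -> a * 2 ^ h <= c * 2 ^ h + c.
Proof.
move=> ba h1 h2 h3; have g0 : 0 < 2 ^ g by rewrite expn_gt0.
have H0 : 0 < 2 ^ h by rewrite expn_gt0.
move: (2 ^ g) (2 ^ h) g0 H0 h1 h2 h3 => G H G0 H0 h1 h2 h3.
have nEba : n * E * b <= n * E * a by rewrite leq_mul2l ba orbT.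
have h4 : a * G <= c * G + 2 * (n * E * a) by lia.
have h5 : G * (a * (2 * H)) <= G * (c * (2 * H) + a).
  have h6 : 2 * (n * E * a) * (2 * H) <= a * G.
    rewrite (_ : 2 * (n * E * a) * (2 * H) = a * (4 * n * E * H)); last by ring.
    by rewrite leq_mul2l h3 orbT.
  have h7 : a * G * (2 * H) <= (c * G + 2 * (n * E * a)) * (2 * H) by rewrite leq_mul2r h4 orbT.
  rewrite (_ : G * (a * (2 * H)) = a * G * (2 * H)); last by ring.
  apply: leq_trans h7 _; rewrite mulnDl.
  rewrite (_ : G * (c * (2 * H) + a) = c * G * (2 * H) + a * G); last by ring.
  by rewrite leq_add2l.
move: h5; rewrite leq_pmul2l // => h5.
have h8 : (2 * H - 1) * a <= 2 * H * c by rewrite mulnBl mul1n; lia.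
have K0 : 0 < 2 * H - 1 by lia.
rewrite -(leq_pmul2l K0) mulnA; apply: (@leq_trans (2 * H * c * H)).
  by rewrite leq_mul2r h8 orbT.
rewrite (_ : 2 * H * c * H = c * (2 * H * H)); last by ring.
rewrite (_ : (2 * H - 1) * (c * H + c) = c * ((2 * H - 1) * (H + 1))); last by ring.
rewrite leq_mul2l; apply/orP; right.
rewrite mulnBl mul1n mulnDr muln1; lia.
Qed.

(** Half of [gain], about n^2/64, absorbs the polynomial and exponential factors; it is at least 4n
    from n = 256 on. *)
Lemma gain_large n : 256 <= n ->
  4 * n * peel_error n * 2 ^ (n ^ 2 %/ 64).+1 <= 2 ^ gain n.
Proof.
move=> hn; set m := n ^ 2 %/ 64.
have hm : 4 * n <= m by rewrite /m leq_divRL // -mulnn; nia.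
have hg : m + m <= gain n.
  rewrite /gain leq_divRL //; have := leq_trunc_div (n ^ 2) 64; rewrite -/m; lia.
apply: leq_trans (_ : 2 ^ (m + m) <= _); last by rewrite leq_exp2l.
apply: leq_trans (_ : 2 ^ (2 + n + (2 * n + (4 + 11)) + m.+1) <= _); last first.
  by rewrite leq_exp2l //; move: hm hn; clear; lia.
rewrite [2 ^ (_ + m.+1)]expnD leq_mul2r; apply/orP; right.
rewrite expnD leq_mul //.
  by rewrite expnD leq_mul // ltnW // ltn_expl.
rewrite /peel_error [2 ^ (2 * n + _)]expnD; apply: leq_mul.
  by rewrite expnM; case: (n) => // u; rewrite leq_exp2r.
by rewrite expnD leq_mul2r orbT.
Qed.

Lemma nb_antichains_ratio : exists n0, forall n, n0 <= n ->
  nb_antichains (@slab n 0 (n.+1 + n)) * 2 ^ (n ^ 2 %/ 64).+1 <=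
  nb_antichains (@slab n n.-1 n.+1) * 2 ^ (n ^ 2 %/ 64).+1
    + nb_antichains (@slab n n.-1 n.+1).
Proof.
have [n0 hn0] := large_requirement.
exists (maxn n0 256) => n; rewrite geq_max => /andP[/hn0[L [L0 nL reqL]] n256].
have f := @nb_antichains_flip n.
have p1 := @peel_all n L L0 nL reqL 0 n (leq0n n).
have p2 := @peel_all n L L0 nL reqL n.-1 n (leq_pred n).
apply: ratio_arith (gain_large n256); last exact: p2.
  apply: nb_antichainsS; apply/subsetP => x; rewrite !inE => /andP[_ ->].
  by rewrite leq0n.
apply: leq_trans p1 _; rewrite leq_add2r leq_mul2r.
by rewrite f orbT.
Qed.

Lemma middle_layersE n : (0 < n)%N -> middle_layers n = @slab n n.-1 n.+1.
Proof.
move=> n0; apply/setP => v; rewrite /middle_layers /layer !inE.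
rewrite -[(\sum_(i < n) _)%N]/(rank v).
by move: (rank v) => r; apply/idP/idP; lia.
Qed.

Lemma slab_full n : [set: grid n] = @slab n 0 (n.+1 + n) :> {set grid n}.
Proof.
apply/setP => v; rewrite !inE /=.
have := rank_compl v; move: (rank v) (rank (compl v)) => r r'; lia.
Qed.

From mathcomp Require Import all_classical all_reals all_analysis.
Import numFieldNormedType.Exports.
Local Open Scope ring_scope.

Theorem theorem1p3 (R : realType) :
  exists2 eps : nat -> R,
    is_exp_neg_Omega (fun n : nat => n%:R ^+ 2) eps &
    forall n : nat,
      (nb_antichains [set: grid n])%:R
        = (1 + eps n) * (nb_antichains (middle_layers n))%:R.
Proof.
pose a n : R := (nb_antichains [set: grid n])%:R.
pose c n : R := (nb_antichains (middle_layers n))%:R.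
have c_gt0 n : 0 < c n by rewrite ltr0n; apply: nb_antichains_gt0.
exists (fun n => a n / c n - 1); last first.
  by move=> n; rewrite addrC subrK divfK // gt_eqF.
(* The error is at most 2^-h, where h, the integer part of n^2/64 plus 1, exceeds n^2/64. *)
exists (ln 2 / 64); first by rewrite divr_gt0 // ln_gt0 // ltr1n.
have [n0 hn0] := nb_antichains_ratio.
exists (maxn n0 1) => // n /=; rewrite geq_max => /andP[/hn0 + n_gt0].
rewrite -middle_layersE // -slab_full; set h := (n ^ 2 %/ 64).+1 => hac.
have ca : c n <= a n by rewrite ler_nat; apply: nb_antichainsS; apply: finset.subsetT.
rewrite ger0_norm; last by rewrite subr_ge0 ler_pdivlMr // mul1r.
apply: (@le_trans _ _ (2 ^- h)).
  rewrite lerBlDr ler_pdivrMr // -(@ler_pM2r _ (2 ^+ h)) ?exprn_gt0 //.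
  have e : 2 ^- h * 2 ^+ h = 1 :> R by rewrite mulVf // expf_neq0.
  move: hac; rewrite -(ler_nat R) natrD !natrM natrX -/(a n) -/(c n).
  move: e; move: (2 ^- h) => u; move: (2 ^+ h) => w e.
  by rewrite mulrDl mul1r mulrDl [u * c n]mulrC -mulrA e mulr1 addrC.
have -> : 2 ^- h = expR (- (ln 2 * h%:R)) :> R.
  by rewrite expRN expRM_natr lnK // posrE.
rewrite ler_expR lerN2 -mulrA ler_pM2l ?ln_gt0 ?ltr1n //.
rewrite mulrC ler_pdivrMr // -natrX -natrM ler_nat ltnW // ltn_ceil //.
Qed.
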